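(* Let $A=\begin{pmatrix} a_{11} & a_{12} \\ a_{21} & a_{22} \end{pmatrix}\in M_2(\mathbb{R})$ satisfy $\det A>0$ and $\mathrm{tr}A<0$. There is a countable set $\Delta_*\subseteq(0,\infty)$ such that for every $d>0$: (i) if $a_{22}+d\,a_{11}<2\sqrt{d\det A}$, then the index of $[\delta,L]\times[0,\lambda_\infty]$ is equal to zero for every $L>0$; (ii) if $a_{22}+d\,a_{11}>2\sqrt{d\det A}$ and $d\notin\Delta_*$, then there is a number $L_0>0$, for which the index of $[\delta,L_0]\times[0,\lambda_\infty]$ is nonzero, such that the index of $[\delta,L]\times[0,\lambda_\infty]$ is defined and nonzero for all $L$ in an open, dense subset of $[L_0,\infty)$.
   Context: Let $D=\mathrm{diag}(1,d)$ and consider on $\mathbb{R}^4$ the system $$\frac{d}{dx}\begin{pmatrix} v \\ w \end{pmatrix}=\begin{pmatrix} 0 & I \\ D^{-1}(\lambda I-A) & 0 \end{pmatrix}\begin{pmatrix} v \\ w \end{pmatrix},\qquad v,w\in\mathbb{R}^2,$$ with Dirichlet boundary conditions. For $x\ge0$, $\lambda\ge0$ let $W(x,\lambda)\in Gr_2(\mathbb{R}^4)$ be the space of values $(v(x),w(x))$ of solutions with $v(0)=0$, and let $P_D=\{(0,p):p\in\mathbb{R}^2\}$. With $e_1^*,\dots,e_4^*$ the standard dual basis of $\mathbb{R}^4$, put $\omega_1=e_1^*\wedge e_2^*$ (whose kernel is $P_D$) and $\omega_2=e_1^*\wedge e_4^*-e_2^*\wedge e_3^*$. Let $\mathcal{M}\subseteq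 Gr_2(\mathbb{R}^4)$ be the set of planes $\mathrm{span}\{u_1,u_2\}$ with $(\omega_1(u_1,u_2),\omega_2(u_1,u_2))\neq(0,0)$, and $\phi\colon\mathcal{M}\to\mathbb{R}P^1$, $\phi(\mathrm{span}\{u_1,u_2\})=[\omega_1(u_1,u_2):\omega_2(u_1,u_2)]$. Let $\tau\colon\mathbb{R}P^1\to S^1$, $\tau([x:y])=\big(\frac{x-iy}{|x-iy|}\big)^2$. For $L>0$, $\lambda_\infty>0$ denotes a number such that $W(x,\lambda)\cap P_D=\{0\}$ for all $0<x\le L$, $\lambda\ge\lambda_\infty$, and $\delta>0$ is a sufficiently small number, so that $W(x,\lambda)\cap P_D=\{0\}$ for all $0<x\le\delta$, $\lambda\in[0,\lambda_\infty]$ (such numbers exist). The index $\mathfrak{m}$ of $[\delta,L]\times[0,\lambda_\infty]$ is defined if $W$ maps the boundary of this rectangle into $\mathcal{M}$, and is then the winding number (degree) of $\tau\circ\phi\circ W$ along the boundary oriented counterclockwise in the $(x,\lambda)$-plane. Saying that the index equals zero (or is nonzero) includes that it is defined. *)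

(* Defs.v *)
From HB Require Import structures.
From mathcomp Require Import all_boot all_order all_algebra.
From mathcomp Require Import complex.
From mathcomp Require Import all_classical all_reals all_analysis.
Set Implicit Arguments.
Unset Strict Implicit.
Unset Printing Implicit Defensive.
Import Order.TTheory GRing.Theory Num.Theory.
Import numFieldNormedType.Exports.
Local Open Scope classical_set_scope.
Local Open Scope ring_scope.
Local Open Scope complex_scope.

Definition diffusion_mx (R : realType) (d : R) : 'M[R]_2 :=
  diag_mx (\row_(j < 2) (if j == 0 then 1 else d)).

Definition system_mx (R : realType) (A : 'M[R]_2) (d lambda : R) : 'M[R]_4 :=
  (block_mx 0 1%:M (invmx (diffusion_mx d) *m (lambda%:M - A)) 0 : 'M[R]_(2 + 2)).

Definition is_solution (R : realType) (A : 'M[R]_2) (d lambda : R)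
    (y : R -> 'cV[R]_4) : Prop :=
  forall x : R, is_derive x 1 y (system_mx A d lambda *m y x).

Definition dirichlet_plane (R : realType) : set 'cV[R]_4 :=
  [set (col_mx 0 p : 'cV[R]_(2 + 2)) | p in [set: 'cV[R]_2]].

Definition solution_values (R : realType) (A : 'M[R]_2) (d x lambda : R) :
    set 'cV[R]_4 :=
  [set y x | y in [set y : R -> 'cV[R]_4 |
                    is_solution A d lambda y /\ dirichlet_plane (y 0)]].

(* Points of Gr_2(R^4) are represented by subspaces of dimension 2. [xget]
   returns the unique subspace whose elements are the values of solutions. *)
Definition W (R : realType) (A : 'M[R]_2) (d x lambda : R) :
    {vspace 'cV[R]_4} :=
  xget 0%VS [set U : {vspace 'cV[R]_4} |
              [set` U] = solution_values A d x lambda].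

Definition dual_basis (R : realType) (i : 'I_4) (u : 'cV[R]_4) : R := u i 0.

Definition wedge (R : realType) (f g : 'cV[R]_4 -> R) (u1 u2 : 'cV[R]_4) : R :=
  f u1 * g u2 - f u2 * g u1.

(* The indices of 'I_4 start from 0. *)
Definition omega1 (R : realType) (u1 u2 : 'cV[R]_4) : R :=
  wedge (dual_basis 0) (dual_basis 1) u1 u2.

Definition omega2 (R : realType) (u1 u2 : 'cV[R]_4) : R :=
  wedge (dual_basis 0) (dual_basis 3) u1 u2
  - wedge (dual_basis 1) (dual_basis 2) u1 u2.

Definition calM (R : realType) : set {vspace 'cV[R]_4} :=
  [set U | \dim U = 2 /\ exists u1 u2 : 'cV[R]_4,
    U = <<[:: u1; u2]>>%VS /\ (omega1 u1 u2, omega2 u1 u2) != (0, 0)].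

(* RP^1 is the set of lines of R^2, [x : y] being the line generated by the
   row (x, y). *)
Definition homog (R : realType) (x y : R) : {vspace 'rV[R]_2} :=
  <[(\row_(j < 2) (if j == 0 then x else y))%R]>%VS.

(* A change of basis multiplies omega1 and omega2 by the same nonzero scalar,
   so on [calM] any basis of U yields the same line. *)
Definition phi (R : realType) (U : {vspace 'cV[R]_4}) : {vspace 'rV[R]_2} :=
  let u1 := (vbasis U)`_0 in let u2 := (vbasis U)`_1 in
  homog (omega1 u1 u2) (omega2 u1 u2).

(* [vpick] chooses homogeneous coordinates; the value does not depend on them. *)
Definition tau (R : realType) (l : {vspace 'rV[R]_2}) : R[i] :=
  let z := (vpick l) 0 0 -i* (vpick l) 0 1 in (z / `|z|) ^+ 2.

(* Degree of a loop gamma : [0, 4] -> S^1, by a continuous choice of argument. *)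
Definition winding_number (R : realType) (gamma : R -> R[i]) (n : int) : Prop :=
  exists theta : R -> R,
    [/\ {within `[0, 4], continuous theta},
        forall t, t \in `[0, 4] -> gamma t = cos (theta t) +i* sin (theta t) &
        theta 4 - theta 0 = n%:~R * (2 * pi)].

(* Boundary of [a, b] x [0, h], counterclockwise from (a, 0), t in [0, 4]. *)
Definition rect_bdry (R : realType) (a b h t : R) : R * R :=
  if t <= 1 then (a + t * (b - a), 0)
  else if t <= 2 then (b, (t - 1) * h)
  else if t <= 3 then (b - (t - 2) * (b - a), h)
  else (a, (4 - t) * h).

Definition W_bdry (R : realType) (A : 'M[R]_2) (d delta L linf t : R) :
    {vspace 'cV[R]_4} :=
  W A d (rect_bdry delta L linf t).1 (rect_bdry delta L linf t).2.

Definition index_is (R : realType) (A : 'M[R]_2) (d delta L linf : R)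
    (n : int) : Prop :=
  (forall t, t \in `[0, 4] -> calM (W_bdry A d delta L linf t)) /\
  winding_number (fun t => tau (phi (W_bdry A d delta L linf t))) n.

Definition transverse (R : realType) (A : 'M[R]_2) (d x lambda : R) : Prop :=
  [set` W A d x lambda] `&` dirichlet_plane (R := R) = [set 0].

Definition admissible (R : realType) (A : 'M[R]_2) (d delta L linf : R) : Prop :=
  [/\ 0 < linf,
      forall x lambda, 0 < x <= L -> linf <= lambda -> transverse A d x lambda,
      0 < delta < L &
      forall x lambda, 0 < x <= delta -> 0 <= lambda <= linf ->
        transverse A d x lambda].

Definition index_zero (R : realType) (A : 'M[R]_2) (d L : R) : Prop :=
  forall delta linf, admissible A d delta L linf ->
    index_is A d delta L linf 0.

Definition index_nonzero (R : realType) (A : 'M[R]_2) (d L : R) : Prop :=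
  forall delta linf, admissible A d delta L linf ->
    exists2 n : int, n != 0 & index_is A d delta L linf n.

(* Main.v *)
Require Import Defs.
From HB Require Import structures.
From mathcomp Require Import all_boot all_order all_algebra.
From mathcomp Require Import complex polyrcf ring lra.
From mathcomp Require Import all_classical all_reals all_analysis.
Import Order.TTheory GRing.Theory Num.Theory.
Import numFieldNormedType.Exports.
Local Open Scope classical_set_scope.
Local Open Scope ring_scope.
Set Implicit Arguments.
Unset Strict Implicit.
Unset Printing Implicit Defensive.

(** Idea. The planes [W x lambda] are spanned by the columns of [(S; S')], where
    [S'' = B S], [S 0 = 0], [S' 0 = 1] and [B = D^-1 (lambda - A)]; hence
    [omega1 = det S] and [omega2 = (det S)'].  The Plücker coordinates of the
    solution satisfy a linear system which decouples, and give
    [2 sqrt (det B) det S = c (rho2) - c (sig2)] with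
    [rho2, sig2 = - tr B -+ 2 sqrt (det B)] and [c m] the solution of
    [y'' = - m y], [y 0 = 1], [y' 0 = 0].  Thus [det S] cannot vanish where
    [rho2 < 0], i.e. where [B] has no negative eigenvalue, and there
    [- atan (omega2 / omega1)] is a continuous argument of [omega1 - i omega2].

    [rho2] is strictly decreasing in [lambda >= 0]; condition (i) says
    [rho2 < 0] at [lambda = 0], so the index is zero.  Under (ii), [rho2] vanishes at
    some [lstar > 0].  For [lambda <= lstar], [B] has eigenvalues [- k1^2, - k2^2] and
    [omega1 - i omega2] is proportional to
    [sin a sin b - i (k1 cos a sin b + k2 sin a cos b)], [a = k1 x], [b = k2 x],
    which is never a positive multiple of [exp (i (a + b))]; so it has a continuous
    argument within [pi] of [pi + a + b].  Gluing both arguments at [(L, lstar)],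
    where [a = b = k L], gives the index [2 n] with [n pi < k L < (n + 1) pi].
    The boundary leaves [calM] exactly when [a] and [b] are both multiples of [pi]
    at one of its points; for each pair of multiples this determines [lambda], hence
    [L] (right side), or restricts [d] to the roots of a polynomial (bottom side). *)

(** * Derivatives and the matrix exponential *)

Section Derivation.
Context {R : realType}.
Implicit Types (f g : R -> R) (x a b : R).

Lemma is_derive_add f g x a b : is_derive x 1 f a -> is_derive x 1 g b ->
  is_derive x 1 (fun t => f t + g t) (a + b).
Proof. exact: is_deriveD. Qed.

Lemma is_derive_sub f g x a b : is_derive x 1 f a -> is_derive x 1 g b ->
  is_derive x 1 (fun t => f t - g t) (a - b).
Proof. exact: is_deriveB. Qed.

Lemma is_derive_mul f g x a b : is_derive x 1 f a -> is_derive x 1 g b ->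
  is_derive x 1 (fun t => f t * g t) (a * g x + f x * b).
Proof.
move=> fa gb; apply: (is_derive_eq (is_deriveM fa gb)).
by rewrite addrC /GRing.scale /= [g x * a]mulrC.
Qed.

Lemma is_derive_scale f x a c : is_derive x 1 f a ->
  is_derive x 1 (fun t => c * f t) (c * a).
Proof. exact: is_deriveZ. Qed.

Lemma is_derive_big (I : finType) (h : I -> R -> R) (dh : I -> R) x :
  (forall i, is_derive x 1 (h i) (dh i)) ->
  is_derive x 1 (fun t => \sum_i h i t) (\sum_i dh i).
Proof.
move=> hd; rewrite (_ : (fun _ => _) = \sum_i h i); last first.
  by apply/funext => t; rewrite fct_sumE.
by elim/big_ind2 : _ => // [|] *; [exact: is_derive_cst|exact: is_deriveD].
Qed.

Lemma is_derive_reflect f x a : is_derive (- x) 1 f a ->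
  is_derive x 1 (fun t => f (- t)) (- a).
Proof.
move=> fa; rewrite -mulrN1.
exact: (@is_derive1_comp _ f -%R x a (-1) fa (is_deriveNid _ _)).
Qed.

Lemma is_derive_mxP m n (M : R -> 'M[R]_(m, n)) x (dM : 'M[R]_(m, n)) :
  is_derive x 1 M dM <-> forall i j, is_derive x 1 (fun t => M t i j) (dM i j).
Proof.
split=> [[Md <-] i j|Md].
  split; first by have /derivable_mxP := Md; exact.
  by rewrite derive_mx // mxE.
have Mx : derivable M x 1 by apply/derivable_mxP => i j; have [] := Md i j.
split=> //; rewrite derive_mx //; apply/matrixP => i j.
by rewrite mxE; have [] := Md i j.
Qed.

End Derivation.

Section MatrixExponential.
Context {R : realType} {n : nat}.
Variable M : 'M[R]_n.+1.

Let coef i j k : R := (M ^+ k) i j / k`!%:R.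

(** Defined entrywise, so that the theory of scalar power series applies. *)
Definition exp_mx (x : R) : 'M[R]_n.+1 :=
  \matrix_(i, j) limn (pseries (coef i j) x).

(** [C] bounds every row sum of absolute values, so each factor [M] costs at most a factor [C]. *)
Lemma exprn_mx_bound : exists C : R, forall i j k, `|(M ^+ k) i j| <= C ^+ k.
Proof.
exists (1 + \sum_i \sum_j `|M i j|) => i j k.
have C0 : 0 <= 1 + \sum_i \sum_j `|M i j|.
  by rewrite addr_ge0 // sumr_ge0 // => ? _; rewrite sumr_ge0.
elim: k i j => [|k IH] i j.
  by rewrite !expr0 mxE; case: (_ == _); rewrite ?normr1 ?normr0.
rewrite exprS mxE (le_trans (ler_norm_sum _ _ _)) //.
apply: (@le_trans _ _ (\sum_l `|M i l| * (1 + \sum_i \sum_j `|M i j|) ^+ k)).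
  by apply: ler_sum => l _; rewrite normrM ler_wpM2l.
rewrite -mulr_suml exprS ler_wpM2r ?exprn_ge0 //.
apply: (@le_trans _ _ (\sum_i \sum_j `|M i j|)); last by rewrite lerDr.
rewrite [leRHS](bigD1 i) //= lerDl.
by rewrite sumr_ge0 // => ? _; rewrite sumr_ge0.
Qed.

Lemma cvg_coef (c : nat -> R) :
  (exists C D : R, forall k, `|c k| <= D * (C ^+ k / k`!%:R)) ->
  forall x, cvgn (pseries c x).
Proof.
move=> [C [D cC]] x; apply: normed_cvg.
have D0 : 0 <= D.
  have := cC 0%N; rewrite expr0 fact0 divr1 mulr1; exact: le_trans.
apply: (@series_le_cvg _ _ (fun k => D * ((`|C| * `|x|) ^+ k / k`!%:R)))
  => [k|k|k|].
- exact: normr_ge0.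
- by rewrite mulr_ge0 // divr_ge0 // exprn_ge0 // mulr_ge0.
- rewrite /= normrM normrX.
  apply: (le_trans (ler_wpM2r _ (cC k))); first by rewrite exprn_ge0.
  rewrite exprMn.
  have -> : D * (`|C| ^+ k * `|x| ^+ k / k`!%:R) =
    D * (`|C| ^+ k / k`!%:R) * `|x| ^+ k by ring.
  apply: ler_wpM2r; first by rewrite exprn_ge0.
  by rewrite ler_wpM2l // ler_wpM2r ?invr_ge0 // -normrX ler_norm.
- exact: (is_cvg_seriesZ (k := D) (is_cvg_series_exp_coeff (`|C| * `|x|))).
Qed.

(** Term-by-term differentiation requires convergence of the series and of its first two formal
    derivatives; the bound on [M ^+ k] settles all orders at once. *)
Lemma cvg_coefD l i j x :
  cvgn (pseries (iter l (@pseries_diffs R) (coef i j)) x).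
Proof.
have [C MC] := exprn_mx_bound.
apply: cvg_coef; exists C, (C ^+ l) => k.
suff -> : iter l (@pseries_diffs R) (coef i j) k = (M ^+ (l + k)) i j / k`!%:R.
  rewrite normrM normfV (ger0_norm (ler0n _ _)) mulrA -exprD.
  by rewrite ler_wpM2r // invr_ge0.
elim: l k => [|l IH] k //=.
rewrite /pseries_diffs IH addnS addSn factS natrM invfM mulrCA.
by rewrite mulVKf // pnatr_eq0.
Qed.

(** The derivative is left as a series in [M ^+ k.+1], which factors with [M] on the left or on the
    right; both formulas for the derivative of the exponential follow. *)
Lemma is_derive_exp_mx_aux i j (x : R) : is_derive x 1 (fun t => exp_mx t i j)
  (limn (pseries (fun k => (M ^+ k.+1) i j / k`!%:R) x)).
Proof.
have -> : (fun t => exp_mx t i j) = fun t => limn (pseries (coef i j) t).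
  by apply/funext => t; rewrite mxE.
have -> : (fun k => (M ^+ k.+1) i j / k`!%:R) = pseries_diffs (coef i j).
  apply/funext => k; rewrite /pseries_diffs /coef factS natrM invfM mulrCA.
  by rewrite mulVKf // pnatr_eq0.
apply: (@pseries_snd_diffs _ (coef i j) (`|x| + 1) x).
- exact: (@cvg_coefD 0 i j _).
- exact: (@cvg_coefD 1 i j _).
- exact: (@cvg_coefD 2 i j _).
- by rewrite [ltRHS]ger0_norm ?addr_ge0 // ltrDl.
Qed.

Lemma lim_pseries_comb (a : 'I_n.+1 -> R) (c : 'I_n.+1 -> nat -> R) x :
  (forall l, cvgn (pseries (c l) x)) ->
  limn (pseries (fun k => \sum_l a l * c l k) x) =
  \sum_l a l * limn (pseries (c l) x).
Proof.
move=> cc; apply/cvg_lim => //.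
rewrite (_ : pseries _ x = fun k => \sum_l a l * pseries (c l) x k); last first.
  apply/funext => k; rewrite /pseries /series /=.
  under eq_bigr do rewrite mulr_suml.
  rewrite exchange_big /=; apply: eq_bigr => l _; rewrite mulr_sumr.
  by apply: eq_bigr => ? _; rewrite mulrA.
apply: cvg_big => [|l _]; first exact: add_continuous.
by apply: cvgMr; exact: cc.
Qed.

Lemma is_derive_exp_mxl (x : R) : is_derive x 1 exp_mx (M *m exp_mx x).
Proof.
apply/is_derive_mxP => i j; apply: is_derive_eq (is_derive_exp_mx_aux i j x) _.
rewrite mxE; under [RHS]eq_bigr do rewrite mxE.
rewrite -lim_pseries_comb; last by move=> l; exact: (@cvg_coefD 0 l j x).
congr (limn (pseries _ x)); apply/funext => k.
by rewrite exprS mxE mulr_suml; apply: eq_bigr => l _; rewrite mulrA.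
Qed.

Lemma is_derive_exp_mxr (x : R) : is_derive x 1 exp_mx (exp_mx x *m M).
Proof.
apply/is_derive_mxP => i j; apply: is_derive_eq (is_derive_exp_mx_aux i j x) _.
rewrite mxE; under [RHS]eq_bigr do rewrite mxE mulrC.
rewrite -lim_pseries_comb; last by move=> l; exact: (@cvg_coefD 0 i l x).
congr (limn (pseries _ x)); apply/funext => k.
rewrite exprSr mxE mulr_suml; apply: eq_bigr => l _.
by rewrite mulrAC mulrC.
Qed.

Lemma exp_mx0 : exp_mx 0 = 1%:M.
Proof.
apply/matrixP => i j; rewrite !mxE; apply: lim_near_cst => //.
near=> k; have k0 : (0 < k)%N by near: k; exact: nbhs_infty_gt.
rewrite /pseries /series /= -(prednK k0) big_nat_recl //= big1 ?addr0.
  by rewrite /coef expr0 fact0 divr1 mulr1 mxE.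
by move=> l _; rewrite expr0n mulr0.
Unshelve. all: by end_near. Qed.

(** The two terms in the derivative of the product cancel. Uniqueness of solutions and, for
    [y = exp_mx], invertibility of the exponential follow from this. *)
Lemma solution_exp_mx m (y : R -> 'M[R]_(n.+1, m)) :
  (forall x : R, is_derive x 1 y (M *m y x)) -> forall x, exp_mx (- x) *m y x = y 0.
Proof.
move=> ysol x; have -> : y 0 = exp_mx (- 0) *m y 0.
  by rewrite oppr0 exp_mx0 mul1mx.
apply/matrixP => i j; rewrite !mxE.
apply: (is_derive_0_is_cst (f := fun t => \sum_k exp_mx (- t) i k * y t k j)) => t.
have /is_derive_mxP yd := ysol t.
have /is_derive_mxP Ed := is_derive_exp_mxr (- t).
apply: (is_derive_eq (is_derive_big (fun k =>
  is_derive_mul (is_derive_reflect (Ed i k)) (yd k j)))).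
have H : (exp_mx (- t) *m M *m y t) i j = (exp_mx (- t) *m (M *m y t)) i j.
  by rewrite mulmxA.
rewrite big_split /= -[X in _ + X](_ : (exp_mx (- t) *m (M *m y t)) i j = _);
  last by rewrite mxE.
rewrite -H mxE -big_split /= big1 // => k _.
by rewrite mulNr addNr.
Qed.

Lemma exp_mxNK x : exp_mx (- x) *m exp_mx x = 1%:M.
Proof. by rewrite (solution_exp_mx is_derive_exp_mxl) exp_mx0. Qed.

Lemma exp_mxKN x : exp_mx x *m exp_mx (- x) = 1%:M.
Proof. by rewrite -{1}(opprK x) exp_mxNK. Qed.

Lemma solutionE m (y : R -> 'M[R]_(n.+1, m)) :
  (forall x : R, is_derive x 1 y (M *m y x)) -> forall x, y x = exp_mx x *m y 0.
Proof.
by move=> ysol x; rewrite -(solution_exp_mx ysol x) mulmxA exp_mxKN mul1mx.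
Qed.

Lemma is_derive_exp_mx_mul m (c : 'M[R]_(n.+1, m)) (x : R) :
  is_derive x 1 (fun t => exp_mx t *m c) (M *m (exp_mx x *m c)).
Proof.
apply/is_derive_mxP => i j.
have /is_derive_mxP Ed := is_derive_exp_mxl x.
have -> : (fun t => (exp_mx t *m c) i j) = fun t => \sum_k c k j * exp_mx t i k.
  by apply/funext => t; rewrite mxE; apply: eq_bigr => k _; rewrite mulrC.
apply: (is_derive_eq (is_derive_big (fun k =>
  is_derive_scale (c k j) (Ed i k)))).
by rewrite mulmxA [RHS]mxE; apply: eq_bigr => k _; rewrite mulrC.
Qed.

End MatrixExponential.

(** * Second order equations and Plücker coordinates *)

Section SecondOrder.
Context {R : realType}.
Implicit Types (f g : R -> R) (m x : R).

Lemma second_order_unique m f f1 :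
  (forall x : R, is_derive x 1 f (f1 x)) ->
  (forall x : R, is_derive x 1 f1 (m * f x)) ->
  f 0 = 0 -> f1 0 = 0 -> forall x, f x = 0 /\ f1 x = 0.
Proof.
move=> df df1 f0 f10 x.
pose M : 'M[R]_2 := \matrix_(i, j) (if i == 0 then (if j == 0 then 0 else 1)
  else if j == 0 then m else 0).
pose y t : 'cV[R]_2 := \col_i (if i == 0 then f t else f1 t).
have ysol (t : R) : is_derive t 1 y (M *m y t).
  apply/is_derive_mxP => i j; rewrite mxE big_ord_recl big_ord1 !mxE /=.
  case: ifPn => i0.
    rewrite (_ : (fun _ => _) = f); last by apply/funext => r; rewrite mxE i0.
    by rewrite mul0r mul1r add0r; exact: df.
  rewrite (_ : (fun _ => _) = f1).
    by rewrite mul0r addr0; exact: df1.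
  by apply/funext => r; rewrite mxE (negbTE i0).
have yx : y x = 0.
  rewrite (solutionE ysol) (_ : y 0 = 0) ?mulmx0 //.
  by apply/matrixP => i j; rewrite !mxE f0 f10 if_same.
have := congr1 (fun z : 'cV[R]_2 => z 0 0) yx.
have := congr1 (fun z : 'cV[R]_2 => z 1 0) yx.
by rewrite !mxE.
Qed.

Definition cosh x : R := (expR x + expR (- x)) / 2.
Definition sinh x : R := (expR x - expR (- x)) / 2.

Lemma is_derive_chain f x a k : is_derive (k * x) 1 f a ->
  is_derive x 1 (fun t => f (k * t)) (k * a).
Proof.
move=> fa; have kd : is_derive x 1 (fun t => k * t) k.
  by rewrite -[X in is_derive _ _ _ X]mulr1; apply: is_derive_scale; exact: is_derive_id.
by rewrite mulrC; exact: (is_derive1_comp fa kd).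
Qed.

Lemma is_derive_cosh (x : R) : is_derive x 1 cosh (sinh x).
Proof.
rewrite (_ : cosh = fun t => 2^-1 * (expR t + expR (- t))).
  rewrite /sinh mulrC; apply: is_derive_scale.
  exact: (is_derive_add (is_derive_expR x) (is_derive_reflect (is_derive_expR (- x)))).
by apply/funext => t; rewrite mulrC.
Qed.

Lemma is_derive_sinh (x : R) : is_derive x 1 sinh (cosh x).
Proof.
rewrite (_ : sinh = fun t => 2^-1 * (expR t - expR (- t))).
  rewrite /cosh mulrC; apply: is_derive_scale.
  rewrite -[X in is_derive _ _ _ (_ + X)]opprK.
  exact: (is_derive_sub (is_derive_expR x) (is_derive_reflect (is_derive_expR (- x)))).
by apply/funext => t; rewrite mulrC.
Qed.

Lemma cosh0 : cosh 0 = 1.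
Proof. by rewrite /cosh oppr0 expR0; field. Qed.

Lemma sinh0 : sinh 0 = 0.
Proof. by rewrite /sinh oppr0 subrr mul0r. Qed.

Lemma ltr_cosh x y : 0 <= x -> x < y -> cosh x < cosh y.
Proof.
move=> x0 xy; rewrite /cosh ltr_pM2r ?invr_gt0 //.
rewrite -subr_gt0 !expRN.
have ex := expR_gt0 x; have ey := expR_gt0 y.
have exy : expR x < expR y by rewrite ltr_expR.
have e1 : 1 < expR x * expR y by rewrite -expRD expR_gt1 ltr_wpDl // (le_lt_trans x0).
have -> : expR y + (expR y)^-1 - (expR x + (expR x)^-1) =
  (expR y - expR x) * (expR x * expR y - 1) / (expR x * expR y).
  by field; rewrite !gt_eqF.
by rewrite divr_gt0 ?mulr_gt0 // subr_gt0.
Qed.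

Lemma cosh_gt1 x : 0 < x -> 1 < cosh x.
Proof. by move=> x0; rewrite -cosh0 ltr_cosh. Qed.

(* As [Num.sqrt] vanishes on negative numbers, this is [cos (sqrt m * x)] for
   [0 <= m] and [cosh (sqrt (- m) * x)] for [m <= 0]: the solution of
   [y'' = - m y], [y 0 = 1], [y' 0 = 0], with [dgcos] its derivative. *)
Definition gcos m x : R := cos (Num.sqrt m * x) * cosh (Num.sqrt (- m) * x).

Definition dgcos m x : R :=
  - Num.sqrt m * sin (Num.sqrt m * x) * cosh (Num.sqrt (- m) * x)
  + cos (Num.sqrt m * x) * (Num.sqrt (- m) * sinh (Num.sqrt (- m) * x)).

Lemma sqrtr_mul_opp m : Num.sqrt m * Num.sqrt (- m) = 0.
Proof.
have [m0|m0] := leP 0 m; last by rewrite ltr0_sqrtr ?mul0r.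
by rewrite (@ler0_sqrtr _ (- m)) ?mulr0 // oppr_le0.
Qed.

Lemma sqr_sqrtr_sub_opp m : Num.sqrt m ^+ 2 - Num.sqrt (- m) ^+ 2 = m.
Proof.
have [m0|m0] := leP 0 m.
  by rewrite sqr_sqrtr // (@ler0_sqrtr _ (- m)) ?oppr_le0 // expr0n subr0.
rewrite ltr0_sqrtr // sqr_sqrtr; last by rewrite oppr_ge0 ltW.
by rewrite expr0n /= sub0r opprK.
Qed.

Lemma is_derive_gcos m x : is_derive x 1 (gcos m) (dgcos m x).
Proof.
apply: is_derive_eq (is_derive_mul (is_derive_chain (is_derive_cos _))
  (is_derive_chain (is_derive_cosh _))) _.
by rewrite /dgcos; ring.
Qed.

Lemma is_derive_dgcos m x : is_derive x 1 (dgcos m) (- m * gcos m x).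
Proof.
apply: is_derive_eq (is_derive_add
  (is_derive_mul (is_derive_scale _ (is_derive_chain (is_derive_sin _)))
    (is_derive_chain (is_derive_cosh _)))
  (is_derive_mul (is_derive_chain (is_derive_cos _))
    (is_derive_scale _ (is_derive_chain (is_derive_sinh _))))) _.
rewrite /gcos; move: (sqrtr_mul_opp m) (sqr_sqrtr_sub_opp m).
move: (Num.sqrt m) (Num.sqrt (- m)) (cos _) (sin _) (cosh _) (sinh _).
move=> p q c s ch sh pq <-.
(* The mixed terms of the derivative add up to a multiple of [p * q], and one of the two roots is
   always zero. *)
have H : p * q * (2 * s * sh) = 0 by rewrite pq mul0r.
lra.
Qed.

Lemma gcos0 m : gcos m 0 = 1.
Proof. by rewrite /gcos !mulr0 cos0 cosh0 mulr1. Qed.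

Lemma dgcos0 m : dgcos m 0 = 0.
Proof. by rewrite /dgcos !mulr0 sin0 sinh0; ring. Qed.

Lemma gcosE m x : 0 <= m -> gcos m x = cos (Num.sqrt m * x).
Proof.
move=> m0; rewrite /gcos (@ler0_sqrtr _ (- m)) ?oppr_le0 //.
by rewrite mul0r cosh0 mulr1.
Qed.

Lemma dgcosE m x : 0 <= m -> dgcos m x = - (Num.sqrt m * sin (Num.sqrt m * x)).
Proof.
move=> m0; rewrite /dgcos (@ler0_sqrtr _ (- m)) ?oppr_le0 //.
by rewrite !mul0r cosh0 mulr0 mulr1 addr0 mulNr.
Qed.

Lemma gcosNE m x : m <= 0 -> gcos m x = cosh (Num.sqrt (- m) * x).
Proof. by move=> m0; rewrite /gcos ler0_sqrtr // mul0r cos0 mul1r. Qed.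

(** A hyperbolic cosine exceeds 1 away from 0, hence any cosine, and grows with its frequency. This
    makes [det S] positive where [rho2 < 0], whatever the sign of [sig2]. *)
Lemma ltr_gcos m k x : m < 0 -> m < k -> 0 < x -> gcos k x < gcos m x.
Proof.
move=> m0 mk x0; rewrite (gcosNE _ (ltW m0)).
have sm : 0 < Num.sqrt (- m) * x by rewrite mulr_gt0 // sqrtr_gt0 oppr_gt0.
have [k0|k0] := leP 0 k.
  by rewrite gcosE // (le_lt_trans (cos_le1 _)) // cosh_gt1.
rewrite (gcosNE _ (ltW k0)) ltr_cosh ?mulr_ge0 ?sqrtr_ge0 ?ltW //.
by rewrite ltr_pM2r // ltr_sqrt ?ltrN2 // oppr_gt0.
Qed.

Lemma gcos_unique m f f1 :
  (forall x : R, is_derive x 1 f (f1 x)) ->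
  (forall x : R, is_derive x 1 f1 (- m * f x)) ->
  f1 0 = 0 -> forall x, f x = f 0 * gcos m x /\ f1 x = f 0 * dgcos m x.
Proof.
move=> df df1 f10 x.
have [|||| H1 H2] := @second_order_unique (- m) (fun t => f t - f 0 * gcos m t)
  (fun t => f1 t - f 0 * dgcos m t) _ _ _ _ x.
- by move=> t; exact: (is_derive_sub (df t) (is_derive_scale _ (is_derive_gcos m t))).
- move=> t; rewrite mulrBr [_ * (f 0 * _)]mulrCA.
  exact: (is_derive_sub (df1 t) (is_derive_scale _ (is_derive_dgcos m t))).
- by rewrite gcos0 mulr1 subrr.
- by rewrite dgcos0 mulr0 f10 subrr.
by split; apply/eqP; rewrite -subr_eq0; apply/eqP.
Qed.

End SecondOrder.

(* The Plücker coordinates [p = S ^ S] and [q = S' ^ S'] of the fundamental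
   matrix of [S'' = B S] satisfy [p'' = tr B p + 2 q], [q'' = 2 det B p + tr B q];
   the combinations [sqrt (det B) p + q] and [sqrt (det B) p - q] decouple. *)
Lemma plucker_gcos (R : realType) (b00 b01 b10 b11 : R)
    (u0 u1 u2 u3 v0 v1 v2 v3 : R -> R) :
  (forall x : R, [/\ is_derive x 1 u0 (u2 x), is_derive x 1 u1 (u3 x),
    is_derive x 1 u2 (b00 * u0 x + b01 * u1 x) &
    is_derive x 1 u3 (b10 * u0 x + b11 * u1 x)]) ->
  (forall x : R, [/\ is_derive x 1 v0 (v2 x), is_derive x 1 v1 (v3 x),
    is_derive x 1 v2 (b00 * v0 x + b01 * v1 x) &
    is_derive x 1 v3 (b10 * v0 x + b11 * v1 x)]) ->
  [/\ u0 0 = 0, u1 0 = 0, u2 0 = 1 & u3 0 = 0] ->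
  [/\ v0 0 = 0, v1 0 = 0, v2 0 = 0 & v3 0 = 1] ->
  0 <= b00 * b11 - b01 * b10 ->
  let s := Num.sqrt (b00 * b11 - b01 * b10) in
  let t := b00 + b11 in
  forall x, 2 * s * (u0 x * v1 x - v0 x * u1 x) =
     gcos (- t - 2 * s) x - gcos (- t + 2 * s) x /\
    2 * s * (u0 x * v3 x - v0 x * u3 x - (u1 x * v2 x - v1 x * u2 x)) =
     dgcos (- t - 2 * s) x - dgcos (- t + 2 * s) x.
Proof.
move=> du dv [u00 u10 u20 u30] [v00 v10 v20 v30] D0 s t x.
have s2 : s * s = b00 * b11 - b01 * b10 by rewrite -expr2 sqr_sqrtr.
pose w (i j k l : R -> R) r := i r * l r - j r * k r.
have dw i j k l (r : R) di dj dk dl : is_derive r 1 i di -> is_derive r 1 j dj ->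
    is_derive r 1 k dk -> is_derive r 1 l dl ->
    is_derive r 1 (w i j k l) (di * l r + i r * dl - (dj * k r + j r * dk)).
  move=> Hi Hj Hk Hl; exact: (is_derive_sub (is_derive_mul Hi Hl) (is_derive_mul Hj Hk)).
pose p := w u0 v0 u1 v1.
pose dp r := w u0 v0 u3 v3 r - w u1 v1 u2 v2 r.
pose q := w u2 v2 u3 v3.
pose dq r := b00 * w u0 v0 u3 v3 r + b01 * w u1 v1 u3 v3 r
  - b10 * w u0 v0 u2 v2 r - b11 * w u1 v1 u2 v2 r.
have Dp (r : R) : is_derive r 1 p (dp r).
  have [du0 du1 du2 du3] := du r; have [dv0 dv1 dv2 dv3] := dv r.
  by apply: is_derive_eq (dw _ _ _ _ _ _ _ _ _ du0 dv0 du1 dv1) _; rewrite /dp /w; ring.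
have Dq (r : R) : is_derive r 1 q (dq r).
  have [du0 du1 du2 du3] := du r; have [dv0 dv1 dv2 dv3] := dv r.
  by apply: is_derive_eq (dw _ _ _ _ _ _ _ _ _ du2 dv2 du3 dv3) _; rewrite /dq /w; ring.
have Ddp (r : R) : is_derive r 1 dp (t * p r + 2 * q r).
  have [du0 du1 du2 du3] := du r; have [dv0 dv1 dv2 dv3] := dv r.
  apply: is_derive_eq (is_derive_sub (dw _ _ _ _ _ _ _ _ _ du0 dv0 du3 dv3)
    (dw _ _ _ _ _ _ _ _ _ du1 dv1 du2 dv2)) _; rewrite /p /q /t /w; ring.
have Ddq (r : R) : is_derive r 1 dq (2 * (s * s) * p r + t * q r).
  have [du0 du1 du2 du3] := du r; have [dv0 dv1 dv2 dv3] := dv r.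
  apply: is_derive_eq (is_derive_sub (is_derive_sub (is_derive_add
    (is_derive_scale b00 (dw _ _ _ _ _ _ _ _ _ du0 dv0 du3 dv3))
    (is_derive_scale b01 (dw _ _ _ _ _ _ _ _ _ du1 dv1 du3 dv3)))
    (is_derive_scale b10 (dw _ _ _ _ _ _ _ _ _ du0 dv0 du2 dv2)))
    (is_derive_scale b11 (dw _ _ _ _ _ _ _ _ _ du1 dv1 du2 dv2))) _.
  by rewrite s2 /p /q /t /w; ring.
have p0 : p 0 = 0 by rewrite /p /w u00 v00; ring.
have q0 : q 0 = 1 by rewrite /q /w u20 u30 v20 v30; ring.
have dp0 : dp 0 = 0 by rewrite /dp /w u00 v00 u10 v10; ring.
have dq0 : dq 0 = 0 by rewrite /dq /w u00 v00 u10 v10; ring.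
(* Sum and difference satisfy [y'' = - m y] with [m = - t - 2 * s] and [m = - t + 2 * s]. They start
   at 1 and -1 with zero derivative, and add up to [2 * s * p]. *)
have HA (r : R) : is_derive r 1 (fun r => s * dp r + dq r)
    (- (- t - 2 * s) * (s * p r + q r)).
  apply: is_derive_eq (is_derive_add (is_derive_scale s (Ddp r)) (Ddq r)) _.
  ring.
have HB (r : R) : is_derive r 1 (fun r => s * dp r - dq r)
    (- (- t + 2 * s) * (s * p r - q r)).
  apply: is_derive_eq (is_derive_sub (is_derive_scale s (Ddp r)) (Ddq r)) _.
  ring.
have A0 : s * dp 0 + dq 0 = 0 by rewrite dp0 dq0 mulr0 addr0.
have B0 : s * dp 0 - dq 0 = 0 by rewrite dp0 dq0 mulr0 subr0.
have [A1 A2] := gcos_unique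
  (fun r => is_derive_add (is_derive_scale s (Dp r)) (Dq r)) HA A0 x.
have [B1 B2] := gcos_unique
  (fun r => is_derive_sub (is_derive_scale s (Dp r)) (Dq r)) HB B0 x.
move: A1 A2 B1 B2; rewrite p0 q0 mulr0 add0r sub0r !mul1r !mulN1r => A1 A2 B1 B2.
rewrite -A1 -A2 -(opprK (gcos (- t + _) x)) -(opprK (dgcos (- t + _) x)) -B1 -B2.
by split; rewrite /p /dp /w; ring.
Qed.

(** * Solution planes and their image on the circle *)

Section SolutionSpace.
Context {R : realType}.
Variables (A : 'M[R]_2) (d lambda : R).
Hypothesis d0 : d != 0.

(** Translates between the blocks of ['I_(2 + 2)] and the numerals of ['I_4]. *)
Lemma col4_lift (p q : 'cV[R]_2) :
  let y : 'cV[R]_4 := (col_mx p q : 'cV[R]_(2 + 2)) in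
  [/\ y 0 0 = p 0 0, y 1 0 = p 1 0, y 2 0 = q 0 0 & y 3 0 = q 1 0].
Proof.
move=> y; split.
- by rewrite -(col_mxEu p q); congr (y _ _); apply: val_inj.
- by rewrite -(col_mxEu p q); congr (y _ _); apply: val_inj.
- by rewrite -(col_mxEd p q); congr (y _ _); apply: val_inj.
- by rewrite -(col_mxEd p q); congr (y _ _); apply: val_inj.
Qed.

Lemma dirichlet_planeP (y : 'cV[R]_4) :
  dirichlet_plane y <-> y 0 0 = 0 /\ y 1 0 = 0.
Proof.
split=> [[p _ <-]|[y0 y1]].
  by have [-> -> _ _] := col4_lift 0 p; rewrite !mxE.
exists (dsubmx (y : 'cV[R]_(2 + 2))) => //.
rewrite -[RHS](vsubmxK (y : 'cV[R]_(2 + 2))); congr col_mx.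
have [/= E0 E1 _ _] := col4_lift (usubmx (y : 'cV[R]_(2 + 2))) (dsubmx (y : 'cV[R]_(2 + 2))).
rewrite vsubmxK in E0 E1.
apply/matrixP => i j; rewrite (ord1 j) mxE.
have : i = 0 \/ i = 1.
  by case: i => -[|[|//]] ?; [left|right]; apply: val_inj.
by case=> ->; rewrite -?E0 -?E1 ?y0 ?y1.
Qed.

Lemma diffusion_mxK (N : 'M[R]_2) :
  let B := invmx (diffusion_mx d) *m N in
  forall j, B 0 j = N 0 j /\ B 1 j = N 1 j / d.
Proof.
move=> B j.
have DB : diffusion_mx d *m B = N.
  rewrite /B mulKVmx // unitmxE det_diag big_ord_recl big_ord1 !mxE /=.
  by rewrite mul1r unitfE.
have E i : N i j = (if i == 0 then 1 else d) * B i j.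
  by rewrite -DB /diffusion_mx mul_diag_mx mxE [X in X * _]mxE.
by rewrite !E /= mul1r mulrAC mulfV ?mul1r.
Qed.

Lemma system_mxE (y : 'cV[R]_4) : let z := system_mx A d lambda *m y in
  [/\ z 0 0 = y 2 0, z 1 0 = y 3 0,
      z 2 0 = (lambda - A 0 0) * y 0 0 + (- A 0 1) * y 1 0 &
      z 3 0 = (- A 1 0 / d) * y 0 0 + ((lambda - A 1 1) / d) * y 1 0].
Proof.
move=> z.
pose p := usubmx (y : 'cV[R]_(2 + 2)); pose q := dsubmx (y : 'cV[R]_(2 + 2)).
have yE : y = (col_mx p q : 'cV[R]_(2 + 2)) by rewrite vsubmxK.
have zE : z = (col_mx q (invmx (diffusion_mx d) *m (lambda%:M - A) *m p)
    : 'cV[R]_(2 + 2)).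
  rewrite /z yE /system_mx (@mul_block_col R 2 2 2 2 1).
  by rewrite !mul0mx mul1mx add0r addr0.
have [Y0 Y1 Y2 Y3] := col4_lift p q.
have [Z0 Z1 Z2 Z3] := col4_lift q (invmx (diffusion_mx d) *m (lambda%:M - A) *m p).
rewrite -yE in Y0 Y1 Y2 Y3; rewrite -zE in Z0 Z1 Z2 Z3.
rewrite Y0 Y1 Y2 Y3 Z0 Z1 Z2 Z3.
have [E00 E10] := diffusion_mxK (lambda%:M - A) 0.
have [E01 E11] := diffusion_mxK (lambda%:M - A) 1.
split=> //; rewrite mxE big_ord_recl big_ord1.
  rewrite (_ : lift _ _ = 1); last exact: val_inj.
  by rewrite E00 E01 !mxE /= sub0r.
rewrite (_ : lift _ _ = 1); last exact: val_inj.
by rewrite E10 E11 !mxE /= sub0r.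
Qed.

(** Columns of the fundamental matrix; columns 2 and 3 start in the Dirichlet plane and form
    [(S; S')]. *)
Definition fund (k : 'I_4) (x : R) : 'cV[R]_4 :=
  exp_mx (system_mx A d lambda) x *m delta_mx k 0.

Lemma fund_solution k : is_solution A d lambda (fund k).
Proof. by move=> x; exact: is_derive_exp_mx_mul. Qed.

Lemma fund0 k : fund k 0 = delta_mx k 0.
Proof. by rewrite /fund exp_mx0 mul1mx. Qed.

Lemma mem_span2 (V : vectType R) (u v w : V) :
  w \in <<[:: u; v]>>%VS <-> exists a b : R, w = a *: u + b *: v.
Proof.
rewrite span_cons span_seq1; split.
  case/memv_addP => _ /vlineP[a ->] [_ /vlineP[b ->] ->].
  by exists a, b.
case=> a [b ->]; apply/memv_addP; exists (a *: u).
  by apply/vlineP; exists a.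
by exists (b *: v) => //; apply/vlineP; exists b.
Qed.

Lemma coord_comb (u v : 'cV[R]_4) (k l : R) i :
  (k *: u + l *: v) i 0 = k * u i 0 + l * v i 0.
Proof. by rewrite !mxE. Qed.

Lemma fund_comb a b x : a *: fund 2 x + b *: fund 3 x =
  exp_mx (system_mx A d lambda) x *m (a *: delta_mx 2 0 + b *: delta_mx 3 0).
Proof. by rewrite mulmxDr -!scalemxAr. Qed.

(** By uniqueness a solution is the exponential applied to its initial value, which here is a
    combination of the last two basis vectors. *)
Lemma solution_values_fund x : solution_values A d x lambda =
  [set` <<[:: fund 2 x; fund 3 x]>>%VS].
Proof.
apply/seteqP; split => [_ [y [ysol /dirichlet_planeP[y0 y1]] <-]|w /=].
  rewrite /=; apply/mem_span2; exists (y 0 2 0), (y 0 3 0).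
  rewrite fund_comb (solutionE ysol); congr (_ *m _).
  apply/matrixP => i j; rewrite (ord1 j) !mxE /=.
  have : [\/ i = 0, i = 1, i = 2 | i = 3].
    case: i => -[|[|[|[|//]]]] ?;
      [constructor 1|constructor 2|constructor 3|constructor 4]; exact: val_inj.
  by case=> ->; rewrite /= ?y0 ?y1 ?mulr0 ?mulr1 ?addr0 ?add0r.
move=> /mem_span2[a [b ->]].
exists (fun t => a *: fund 2 t + b *: fund 3 t) => //; split.
  move=> t; rewrite fund_comb.
  rewrite (_ : (fun _ => _) = fun t => exp_mx (system_mx A d lambda) t *m
    (a *: delta_mx 2 0 + b *: delta_mx 3 0)).
    exact: is_derive_exp_mx_mul.
  by apply/funext => r; rewrite fund_comb.
by apply/dirichlet_planeP; rewrite fund_comb exp_mx0 mul1mx !mxE /= !mulr0 addr0.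
Qed.

(** A subspace is determined by its elements, so [xget] returns the span of the two columns and
    never its default value. *)
Lemma W_fund x : W A d x lambda = <<[:: fund 2 x; fund 3 x]>>%VS.
Proof.
rewrite /W; set P := [set U | _].
have PU : P <<[:: fund 2 x; fund 3 x]>>%VS := esym (solution_values_fund x).
have E : [set` xget 0%VS P] = [set` <<[:: fund 2 x; fund 3 x]>>%VS].
  by rewrite -solution_values_fund; exact: (xgetI 0%VS PU).
apply/vspaceP => w; have /= Ew := congr1 (fun S : set _ => S w) E.
by apply/idP/idP; rewrite Ew.
Qed.

Lemma fund_comb_eq0 a b x : a *: fund 2 x + b *: fund 3 x = 0 -> a = 0 /\ b = 0.
Proof.
rewrite fund_comb => /(congr1 (mulmx (exp_mx (system_mx A d lambda) (- x)))).
rewrite mulmxA exp_mxNK mul1mx mulmx0 => E.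
have := congr1 (fun z : 'cV[R]_4 => z 3 0) E.
have := congr1 (fun z : 'cV[R]_4 => z 2 0) E.
by rewrite !mxE /= !mulr1 !mulr0 addr0 add0r.
Qed.

Lemma dim_W x : \dim (W A d x lambda) = 2.
Proof.
rewrite W_fund; suff /eqP : free [tuple fund 2 x; fund 3 x] by [].
apply/freeP => k; rewrite big_ord_recl big_ord1 /= => /fund_comb_eq0[k0 k1] i.
case: i => -[|[|//]] Hi; [rewrite -[RHS]k0|rewrite -[RHS]k1];
  by congr (k _); apply: val_inj.
Qed.

Lemma transverse_omega1 x : transverse A d x lambda ->
  omega1 (fund 2 x) (fund 3 x) != 0.
Proof.
move=> tr; apply/eqP => o1.
pose a := fund 2 x 0 0; pose b := fund 2 x 1 0.
pose a' := fund 3 x 0 0; pose b' := fund 3 x 1 0.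
have {}o1 : a * b' - a' * b = 0 := o1.
have key k l : k * a + l * a' = 0 -> k * b + l * b' = 0 -> k = 0 /\ l = 0.
  move=> E0 E1; apply: (@fund_comb_eq0 _ _ x).
  suff : [set 0] (k *: fund 2 x + l *: fund 3 x) by [].
  rewrite -tr; split; last first.
    by apply/dirichlet_planeP; rewrite !coord_comb.
  by rewrite /= W_fund; apply/mem_span2; exists k, l.
(* The coefficients are cofactors of the vanishing minor, so both combinations lie in the Dirichlet
   plane. Transversality then makes all four entries vanish, and [fund 2 x] itself lies in that
   plane. *)
have [||b'0 /eqP] := key b' (- b); rewrite ?oppr_eq0; [lra|lra|move=> /eqP bz].
have [||a'0 /eqP] := key a' (- a); rewrite ?oppr_eq0; [lra|lra|move=> /eqP az].
have [] := key 1 0; rewrite ?az ?a'0 ?bz ?b'0 ?mulr0 ?addr0 //.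
by move=> /eqP; rewrite oner_eq0.
Qed.

Let disc := ((lambda - A 0 0) * ((lambda - A 1 1) / d) - (- A 0 1) * (- A 1 0 / d)).
Let trB := (lambda - A 0 0) + (lambda - A 1 1) / d.

Lemma omega_gcos x : 0 <= disc ->
  2 * Num.sqrt disc * omega1 (fund 2 x) (fund 3 x) =
    gcos (- trB - 2 * Num.sqrt disc) x - gcos (- trB + 2 * Num.sqrt disc) x /\
  2 * Num.sqrt disc * omega2 (fund 2 x) (fund 3 x) =
    dgcos (- trB - 2 * Num.sqrt disc) x - dgcos (- trB + 2 * Num.sqrt disc) x.
Proof.
move=> D0.
have fd k (t : R) : [/\ is_derive t 1 (fun t => fund k t 0 0) (fund k t 2 0),
   is_derive t 1 (fun t => fund k t 1 0) (fund k t 3 0),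
   is_derive t 1 (fun t => fund k t 2 0)
     ((lambda - A 0 0) * fund k t 0 0 + (- A 0 1) * fund k t 1 0) &
   is_derive t 1 (fun t => fund k t 3 0)
     ((- A 1 0 / d) * fund k t 0 0 + ((lambda - A 1 1) / d) * fund k t 1 0)].
  have /is_derive_mxP H := @fund_solution k t.
  have [E0 E1 E2 E3] := system_mxE (fund k t).
  by split; apply: is_derive_eq (H _ 0) _.
have [||E1 E2] := plucker_gcos (fd 2) (fd 3) _ _ D0 x.
- by rewrite fund0 !mxE.
- by rewrite fund0 !mxE.
rewrite -/disc -/trB in E1 E2; split.
  by rewrite -E1 /omega1 /wedge /dual_basis; ring.
by rewrite -E2 /omega2 /wedge /dual_basis; ring.
Qed.

End SolutionSpace.

(** * Homogeneous coordinates and the map to the circle *)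

Section Angle.
Context {R : realType}.
Local Open Scope complex_scope.

(** The sign of the real factor [c] survives the normalization and disappears in the square. *)
Lemma sqr_sign_homothety (c : R) (z : R[i]) : c != 0 ->
  (c%:C * z / `|c%:C * z|) ^+ 2 = (z / `|z|) ^+ 2.
Proof.
move=> c0; rewrite normrM invfM mulrACA exprMn.
have cn : `|c%:C| = `|c|%:C.
  by rewrite normc_def /= expr0n /= addr0 sqrtr_sqr.
rewrite cn expr_div_n -!rmorphXn /= real_normK ?num_real //.
by rewrite divff ?mul1r // -(rmorph0 (real_complex R)) (inj_eq (@complexI _)) expf_neq0.
Qed.

Lemma tau_homog (x y c : R) : c != 0 -> (x, y) != (0, 0) ->
  tau (homog (c * x) (c * y)) = ((x -i* y) / `|x -i* y|) ^+ 2.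
Proof.
move=> c0 xy0; rewrite /tau /homog; set r := \row_j _.
have rn0 : r != 0.
  apply: contra xy0 => /eqP r0.
  have := congr1 (fun z : 'rV[R]_2 => z 0 0) r0.
  have := congr1 (fun z : 'rV[R]_2 => z 0 1) r0.
  rewrite !mxE /= => /eqP; rewrite mulf_eq0 (negbTE c0) /= => /eqP ->.
  by move/eqP; rewrite mulf_eq0 (negbTE c0) /= => /eqP ->.
have /vlineP[k kE] := memv_pick <[r]>%VS.
have k0 : k != 0.
  apply: contra rn0 => /eqP k0; move: kE; rewrite k0 scale0r => /eqP.
  by rewrite vpick0 -subv0 -memvE memv0.
rewrite kE !mxE /=.
have -> : (k * (c * x)) -i* (k * (c * y)) = (k * c)%:C * (x -i* y).
  by apply/eqP; rewrite eq_complex /=; apply/andP; split; apply/eqP; ring.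
by rewrite sqr_sign_homothety // mulf_neq0.
Qed.

Lemma calM_span2 (u v : 'cV[R]_4) (U : {vspace 'cV[R]_4}) :
  \dim U = 2 -> U = <<[:: u; v]>>%VS -> (omega1 u v, omega2 u v) != (0, 0) ->
  calM U.
Proof. by move=> ? ? ?; split=> //; exists u, v. Qed.

(** Passing from [vbasis U] to [u, v] multiplies both forms by the determinant [p * q' - q * p'];
    this factor and [c] drop out of homogeneous coordinates. *)
Lemma tau_phi_span2 (u v : 'cV[R]_4) (U : {vspace 'cV[R]_4}) (x y c : R) :
  \dim U = 2 -> U = <<[:: u; v]>>%VS -> (x, y) != (0, 0) ->
  c * omega1 u v = x -> c * omega2 u v = y ->
  tau (phi U) = ((x -i* y) / `|x -i* y|) ^+ 2.
Proof.
move=> dU UE xy0 o1 o2; rewrite /phi; set b0 := _`_0; set b1 := _`_1.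
have UV : U = <<[:: b0; b1]>>%VS.
  rewrite -[LHS](span_basis (vbasisP U)) /b0 /b1; congr span.
  have : size (vbasis U) = 2 by rewrite size_tuple.
  by case: (tval (vbasis U)) => [|? [|? [|]]].
have /mem_span2[p [q uE]] : u \in <<[:: b0; b1]>>%VS.
  by rewrite -UV UE memv_span // inE eqxx.
have /mem_span2[p' [q' vE]] : v \in <<[:: b0; b1]>>%VS.
  by rewrite -UV UE memv_span // !inE eqxx orbT.
have E1 : omega1 u v = (p * q' - q * p') * omega1 b0 b1.
  by rewrite /omega1 /wedge /dual_basis uE vE !mxE; ring.
have E2 : omega2 u v = (p * q' - q * p') * omega2 b0 b1.
  by rewrite /omega2 /wedge /dual_basis uE vE !mxE; ring.
pose D := c * (p * q' - q * p').
have xE : x = D * omega1 b0 b1 by rewrite -o1 E1 /D mulrA.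
have yE : y = D * omega2 b0 b1 by rewrite -o2 E2 /D mulrA.
have D0 : D != 0.
  by apply: contra xy0 => /eqP D0; rewrite xE yE D0 !mul0r.
have -> : omega1 b0 b1 = D^-1 * x by rewrite xE mulKf.
have -> : omega2 b0 b1 = D^-1 * y by rewrite yE mulKf.
by apply: tau_homog => //; rewrite invr_neq0.
Qed.

Lemma sqr_sign_polar (N a : R) : N != 0 ->
  (((N * cos a) -i* (- (N * sin a))) / `|(N * cos a) -i* (- (N * sin a))|) ^+ 2 =
  cos (2 * a) +i* sin (2 * a).
Proof.
move=> N0.
have -> : (N * cos a) -i* (- (N * sin a)) = N%:C * (cos a +i* sin a).
  by apply/eqP; rewrite eq_complex /=; apply/andP; split; apply/eqP; ring.
rewrite sqr_sign_homothety // normc_def /= cos2Dsin2 sqrtr1 divr1.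
rewrite expr2 mulr_natl mulr2n cosD sinD.
by apply/eqP; rewrite eq_complex /=; apply/andP; split; apply/eqP; ring.
Qed.

End Angle.

(** * Arguments of [omega1 - i omega2] *)

Section Phase.
Context {R : realType}.
Implicit Types X Y a b k t x : R.

Definition phase_dot X Y t : R := - X * cos t + Y * sin t.
Definition phase_cross X Y t : R := X * sin t + Y * cos t.
Definition modulus X Y : R := Num.sqrt (X ^+ 2 + Y ^+ 2).

(* The argument of [X - i Y] in the branch near [pi + t]: [phase_dot] and
   [phase_cross] are the real and imaginary parts of [- (X - i Y) exp (- i t)],
   whose principal argument is computed by the half-angle formula. *)
Definition phase X Y t : R :=
  pi + t + 2 * atan (phase_cross X Y t / (modulus X Y + phase_dot X Y t)).

Lemma dot_cross_sqr X Y t :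
  phase_dot X Y t ^+ 2 + phase_cross X Y t ^+ 2 = modulus X Y ^+ 2.
Proof.
rewrite /modulus sqr_sqrtr ?addr_ge0 ?sqr_ge0 // -[RHS]mulr1 -(cos2Dsin2 t).
by rewrite /phase_dot /phase_cross; ring.
Qed.

Lemma sqr_cos_atan x : cos (atan x) ^+ 2 = (1 + x ^+ 2)^-1.
Proof. by rewrite cos_atan exprVn sqr_sqrtr // addr_ge0 ?sqr_ge0. Qed.

Lemma cos_atan_gt0 x : 0 < cos (atan x).
Proof. by apply: cos_gt0_pihalf; rewrite atan_gtNpi2 atan_ltpi2. Qed.

Lemma sin_atan x : sin (atan x) = x * cos (atan x).
Proof. by rewrite -{2}(atanK x) /tan divfK // gt_eqF // cos_atan_gt0. Qed.

Lemma modulus_gt0 X Y t : 0 < modulus X Y + phase_dot X Y t -> 0 < modulus X Y.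
Proof.
move=> NP; rewrite lt_def {2}/modulus sqrtr_ge0 andbT.
apply: contraTneq NP => N0.
have := dot_cross_sqr X Y t; rewrite N0 expr0n /= add0r => /eqP.
rewrite paddr_eq0 ?sqr_ge0 // !sqrf_eq0 => /andP[/eqP -> _].
by rewrite ltxx.
Qed.

(** With [u = q / (N + p)], the double-angle formulas give [N * cos (2 * atan u) = p] and
    [N * sin (2 * atan u) = q]; rotating back by [pi + t] recovers [X - i Y]. The hypothesis
    excludes exactly the nonnegative multiples of [exp (i t)]. *)
Lemma phase_polar X Y t : 0 < modulus X Y + phase_dot X Y t ->
  X = modulus X Y * cos (phase X Y t) /\ Y = - (modulus X Y * sin (phase X Y t)).
Proof.
move=> NP; have N0 := modulus_gt0 NP; have sq := dot_cross_sqr X Y t.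
rewrite /phase; set q := phase_cross X Y t in sq *; set p := phase_dot X Y t in NP sq *.
set N := modulus X Y in NP N0 sq *; set u := q / (N + p).
have c2 : cos (atan u) ^+ 2 = (N + p) / (2 * N).
  rewrite sqr_cos_atan -invf_div; congr (_^-1).
  rewrite /u expr_div_n (_ : q ^+ 2 = N ^+ 2 - p ^+ 2); last by rewrite -sq; ring.
  by field; rewrite !gt_eqF.
have uN : u * (N + p) = q by rewrite /u divfK // gt_eqF.
have cs : N * cos (2 * atan u) = p.
  rewrite mulr_natl cos_mulr2n -mulr_natl c2; field; exact: lt0r_neq0.
have sn : N * sin (2 * atan u) = q.
  rewrite mulr_natl sin_mulr2n -mulr_natl sin_atan.
  have -> : 2 * (cos (atan u) * (u * cos (atan u))) = 2 * u * cos (atan u) ^+ 2 by ring.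
  by rewrite c2 -uN; field; exact: lt0r_neq0.
have -> : pi + t + 2 * atan u = (t + 2 * atan u) + pi by ring.
rewrite cosDpi sinDpi cosD sinD !mulrN !mulrBr !mulrDr.
rewrite ![N * (_ * _)]mulrCA cs sn /p /q /phase_dot /phase_cross.
have E := cos2Dsin2 t.
split; [rewrite -[LHS]mulr1 -E|rewrite -[LHS]mulr1 -E]; ring.
Qed.

(** With [a = k1 x] and [b = k2 x], [prodX] and [prodY] are [planeX] and [planeY]; the factor 2
    comes from [cos (a - b) - cos (a + b) = 2 sin a sin b]. *)
Definition prodX a b : R := 2 * (sin a * sin b).
Definition prodY k1 k2 a b : R := 2 * (k1 * (cos a * sin b) + k2 * (sin a * cos b)).

(** Otherwise [X - i Y = p exp (i (a + b))] with [p >= 0]. If [p = 0], both coordinates vanish; if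
    [p > 0], the addition formulas produce a vanishing sum of squares, which forces sine and cosine
    of the same angle to vanish. *)
Lemma prod_phase_gt0 k1 k2 a b : 0 < k1 -> 0 < k2 ->
  (prodX a b, prodY k1 k2 a b) != (0, 0) ->
  0 < modulus (prodX a b) (prodY k1 k2 a b) +
      phase_dot (prodX a b) (prodY k1 k2 a b) (a + b).
Proof.
move=> k10 k20; apply: contraNlt => NP.
set X := prodX a b in NP *; set Y := prodY k1 k2 a b in NP *.
have sq := dot_cross_sqr X Y (a + b).
have N0 : 0 <= modulus X Y := sqrtr_ge0 _.
set N := modulus X Y in NP sq N0; pose p := - phase_dot X Y (a + b).
have pN : N <= p by rewrite /p; lra.
have p0 : 0 <= p by exact: le_trans pN.
have q0 : phase_cross X Y (a + b) = 0.
  apply/eqP; rewrite -sqrf_eq0 eq_le sqr_ge0 andbT.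
  have : N ^+ 2 <= p ^+ 2 by rewrite ler_sqr.
  by rewrite -sq /p sqrrN; lra.
have E := cos2Dsin2 (a + b).
have XE : X = p * cos (a + b).
  rewrite -[LHS]mulr1 -E -[RHS]addr0 -(mulr0 (sin (a + b))) -q0 /p.
  by rewrite /phase_dot /phase_cross; ring.
have YE : Y = - (p * sin (a + b)).
  rewrite -[LHS]mulr1 -E -[RHS]addr0 -(mulr0 (cos (a + b))) -q0 /p.
  by rewrite /phase_dot /phase_cross; ring.
have [pz|pnz] := eqVneq p 0; first by rewrite XE YE pz !mul0r oppr0.
have {p0 pnz}p0 : 0 < p by rewrite lt_def pnz.
exfalso; move: XE YE; rewrite /X /Y /prodX /prodY cosD sinD.
have := cos2Dsin2 a; have := cos2Dsin2 b.
move: (cos a) (sin a) (cos b) (sin b) => ca sa cb sb Eb Ea E1 E2.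
have e1 : (2 + p) * (sa * sb) = p * (ca * cb) by lra.
have e2 : (2 * k1 + p) * (ca * sb) + (2 * k2 + p) * (sa * cb) = 0 by lra.
have k1p : 0 < 2 * k1 + p by lra.
have k2p : 0 < 2 * k2 + p by lra.
have p2 : 0 < 2 + p by lra.
(* Multiplying [e2] by [(2 + p) * (ca * sb)] and removing the mixed product by [e1] leaves two
   squares with positive coefficients. *)
have e3 : (2 + p) * (2 * k1 + p) * (ca * sb) ^+ 2 + (2 * k2 + p) * p * (ca * cb) ^+ 2 = 0.
  transitivity ((2 + p) * (ca * sb) * ((2 * k1 + p) * (ca * sb) + (2 * k2 + p) * (sa * cb))
     - (2 * k2 + p) * (ca * cb) * ((2 + p) * (sa * sb) - p * (ca * cb))).
    by ring.
  by rewrite e2 e1; ring.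
have nn c x : 0 < c -> 0 <= c * x ^+ 2.
  by move=> c0; rewrite mulr_ge0 ?sqr_ge0 // ltW.
move/eqP: e3; rewrite paddr_eq0; [|by apply: nn; rewrite mulr_gt0..].
rewrite ![_ * _ ^+ 2 == 0]mulf_eq0 !sqrf_eq0 ![_ * (_ + p) == 0]mulf_eq0.
rewrite [_ * p == 0]mulf_eq0.
rewrite (gt_eqF p2) (gt_eqF k1p) (gt_eqF k2p) (gt_eqF p0) /= => /andP[/eqP z1 /eqP z2].
have ca0 : ca = 0.
  apply/eqP; rewrite -sqrf_eq0; apply/eqP.
  transitivity (ca * sb * (ca * sb) + ca * cb * (ca * cb)); last by rewrite z1 z2; ring.
  by rewrite -[LHS]mulr1 -Eb; ring.
have sa0 : sa != 0.
  by apply/eqP => sa0; move: Ea; rewrite ca0 sa0; lra.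
have cb0 : cb = 0.
  move/eqP: e2; rewrite ca0 mul0r mulr0 add0r !mulf_eq0 (gt_eqF k2p) (negbTE sa0) /=.
  by move/eqP.
have sb0 : sb = 0.
  move/eqP: e1; rewrite ca0 mul0r mulr0 !mulf_eq0 (gt_eqF p2) (negbTE sa0) /=.
  by move/eqP.
by move: Eb; rewrite cb0 sb0; lra.
Qed.

(** [N] has the sign of [X]: the arctangent yields an argument modulo [pi], which is enough after
    the squaring in [tau]. *)
Lemma atan_polar X Y : X != 0 ->
  let N := X / cos (atan (Y / X)) in
  [/\ N != 0, X = N * cos (- atan (Y / X)) & Y = - (N * sin (- atan (Y / X)))].
Proof.
move=> X0 N; have c0 := lt0r_neq0 (cos_atan_gt0 (Y / X)).
split; first by rewrite /N mulf_neq0 // invr_neq0.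
  by rewrite cosN /N divfK.
rewrite sinN mulrN opprK sin_atan /N.
by field; rewrite X0 c0.
Qed.

Lemma atan_gt0 x : 0 < x -> 0 < atan x.
Proof. by move=> x0; rewrite -(@atan0 R) lt_atan. Qed.

Lemma atan_lt0 x : x < 0 -> atan x < 0.
Proof. by move=> x0; rewrite -[ltRHS](@atan0 R) lt_atan. Qed.

Lemma cos_eq1_4pi x : cos x = 1 -> 0 < x < 4 * pi -> x = 2 * pi.
Proof.
move=> cx /andP[x0 x4].
have s0 : sin (x / 2) = 0.
  have : cos (x / 2 *+ 2) = 1 by rewrite -mulr_natl mulrC divfK.
  rewrite cos_mulr2n => c2; apply/eqP; rewrite -sqrf_eq0 sin2cos2; apply/eqP.
  by move: c2; rewrite -mulr_natl; lra.
have [lt|gt|E] := ltgtP (x / 2) pi; last by rewrite -E; field.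
  have : 0 < sin (x / 2) by apply: sin_gt0_pi; rewrite lt andbT; lra.
  by rewrite s0 ltxx.
have : 0 < sin (x / 2 - pi) by apply: sin_gt0_pi; apply/andP; split; lra.
have := @sinDpi R (x / 2 - pi); rewrite subrK s0 => /esym/eqP.
by rewrite oppr_eq0 => /eqP ->; rewrite ltxx.
Qed.

(** Both sides are arguments of the same number, hence differ by a multiple of [2 pi]; bounds on the
    arctangents select the multiple. *)
Lemma phase_base k1 k2 a b : 0 < k1 -> 0 < k2 -> 0 < a < pi -> 0 < b < pi ->
  phase (prodX a b) (prodY k1 k2 a b) (a + b) =
  2 * pi - atan (prodY k1 k2 a b / prodX a b).
Proof.
move=> k10 k20 ha hb.
have /andP[a0 ap] := ha; have /andP[b0 bp] := hb.
have sa : 0 < sin a by exact: sin_gt0_pi.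
have sb : 0 < sin b by exact: sin_gt0_pi.
have X0 : 0 < prodX a b by rewrite /prodX !mulr_gt0.
have nz : (prodX a b, prodY k1 k2 a b) != (0, 0).
  by rewrite xpair_eqE negb_and gt_eqF.
have NP := prod_phase_gt0 k10 k20 nz.
have N0 := modulus_gt0 NP.
have [PX PY] := phase_polar NP.
have [_ AX AY] := atan_polar (prodY k1 k2 a b) (lt0r_neq0 X0).
have pig := @pi_gt0 R.
set X := prodX a b in X0 nz NP N0 PX PY AX AY *.
set Y := prodY k1 k2 a b in nz NP N0 PX PY AX AY *.
set f := phase X Y (a + b) in PX PY *; set g := atan (Y / X) in AX AY *.
have cg : 0 < cos g by exact: cos_atan_gt0.
have M0 : 0 < X / cos g by rewrite divr_gt0.
have gl : - (pi / 2) < g by exact: atan_gtNpi2.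
have gr : g < pi / 2 by exact: atan_ltpi2.
have fE : f = pi + (a + b) + 2 * atan (phase_cross X Y (a + b) /
  (modulus X Y + phase_dot X Y (a + b))) by [].
set h := atan _ in fE.
have hl : - (pi / 2) < h by exact: atan_gtNpi2.
have hr : h < pi / 2 by exact: atan_ltpi2.
suff : f + g = 2 * pi by lra.
apply: cos_eq1_4pi.
  have M : modulus X Y = X / cos g.
    apply/eqP; rewrite -(@eqrXn2 _ 2) ?ltW //; apply/eqP.
    rewrite /modulus sqr_sqrtr ?addr_ge0 ?sqr_ge0 //.
    rewrite -[RHS]mulr1 -(cos2Dsin2 (- g)).
    by move: (X / cos g) AX AY => M -> ->; ring.
  rewrite cosD; have e2 := cos2Dsin2 (- g).
  have c1 : cos f = cos (- g).
    by apply: (mulfI (lt0r_neq0 M0)); rewrite -AX -M -PX.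
  have s1 : sin f = sin (- g).
    by apply: (mulfI (lt0r_neq0 M0)); apply: oppr_inj; rewrite -AY -M -PY.
  by rewrite c1 s1 -e2 cosN sinN; ring.
(* As [g] and [h] lie within [pi / 2] of 0, [f + g = pi + (a + b) + 2 h + g] is in []0, 4 pi[] when
   [pi / 2 <= a + b <= 3 pi / 2]; outside this range the sign of [h] is used as well. *)
have Ysign : (a + b < pi / 2 -> 0 < h) /\ (3 * pi / 2 < a + b -> h < 0).
  split=> ab.
    apply: atan_gt0; rewrite divr_gt0 // /phase_cross.
    have cab : 0 < cos (a + b) by apply: cos_gt0_pihalf; apply/andP; split; lra.
    have sab : 0 < sin (a + b) by apply: sin_gt0_pi; apply/andP; split; lra.
    have ca : 0 < cos a by apply: cos_gt0_pihalf; apply/andP; split; lra.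
    have cb : 0 < cos b by apply: cos_gt0_pihalf; apply/andP; split; lra.
    have Y0 : 0 < Y.
      apply: mulr_gt0 => //.
      by apply: addr_gt0; apply: mulr_gt0 => //; apply: mulr_gt0.
    by apply: addr_gt0; apply: mulr_gt0.
  apply: atan_lt0; rewrite ltr_pdivrMr // mul0r /phase_cross.
  pose c := 2 * pi - (a + b).
  have abE : a + b = - c + pi *+ 2 by rewrite /c -mulr_natl; ring.
  have cab : 0 < cos (a + b).
    by rewrite abE cosD2pi cosN; apply: cos_gt0_pihalf; rewrite /c;
      apply/andP; split; lra.
  have sab : sin (a + b) < 0.
    by rewrite abE sinD2pi sinN oppr_lt0; apply: sin_gt0_pi; rewrite /c;
      apply/andP; split; lra.
  have neg x : pi / 2 < x -> x < pi -> cos x < 0.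
    move=> x1 x2; rewrite -(subrK pi x) cosDpi oppr_lt0.
    by apply: cos_gt0_pihalf; apply/andP; split; lra.
  have ca : cos a < 0 by apply: neg; lra.
  have cb : cos b < 0 by apply: neg; lra.
  have Y0 : Y < 0.
    rewrite /Y /prodY pmulr_rlt0 // -[ltRHS]addr0.
    apply: ltrD; rewrite pmulr_rlt0 //; first by rewrite nmulr_rlt0.
    by rewrite pmulr_rlt0.
  by rewrite -[ltRHS]addr0; apply: ltrD; [rewrite pmulr_rlt0|rewrite nmulr_rlt0].
have [Y1 Y2] := Ysign.
apply/andP; split.
  by have [/Y1|] := ltP (a + b) (pi / 2); lra.
by have [/Y2|] := ltP (3 * pi / 2) (a + b); lra.
Qed.

End Phase.

(** * Dependence on [x] and [lambda] *)

Section PlaneCoordinates.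
Context {R : realType}.
Implicit Types (A : 'M[R]_2) (d l x : R).

(** Trace and determinant of [B = D^-1 (l - A)]. *)
Definition block_tr A d l : R := (l - A 0 0) + (l - A 1 1) / d.
Definition block_det A d l : R :=
  (l - A 0 0) * ((l - A 1 1) / d) - (- A 0 1) * (- A 1 0 / d).
(** If [B] has eigenvalues [- k1^2] and [- k2^2] with positive [k1, k2], these are [(k1 - k2)^2] and
    [(k1 + k2)^2]. *)
Definition rho2 A d l : R := - block_tr A d l - 2 * Num.sqrt (block_det A d l).
Definition sig2 A d l : R := - block_tr A d l + 2 * Num.sqrt (block_det A d l).
(** For [0 <= l], these turn out to be [omega1] and [omega2] of the columns of [(S; S')], scaled by
    [2 * Num.sqrt (block_det A d l)]. *)
Definition planeX A d x l : R := gcos (rho2 A d l) x - gcos (sig2 A d l) x.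
Definition planeY A d x l : R := dgcos (rho2 A d l) x - dgcos (sig2 A d l) x.

Section Continuity.
Context {T : topologicalType} (t : T).
Implicit Types f g : T -> R.

Lemma continuous_at_sqrt f : continuous_at t f ->
  continuous_at t (fun s => Num.sqrt (f s)).
Proof. by move=> fc; apply: (continuous_comp fc); exact: sqrt_continuous. Qed.

Lemma continuous_at_sin f : continuous_at t f ->
  continuous_at t (fun s => sin (f s)).
Proof. by move=> fc; apply: (continuous_comp fc); exact: continuous_sin. Qed.

Lemma continuous_at_cos f : continuous_at t f ->
  continuous_at t (fun s => cos (f s)).
Proof. by move=> fc; apply: (continuous_comp fc); exact: continuous_cos. Qed.

Lemma continuous_at_atan f : continuous_at t f ->
  continuous_at t (fun s => atan (f s)).
Proof. by move=> fc; apply: (continuous_comp fc); exact: continuous_atan. Qed.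

Lemma continuous_at_expR f : continuous_at t f ->
  continuous_at t (fun s => expR (f s)).
Proof. by move=> fc; apply: (continuous_comp fc); exact: continuous_expR. Qed.

Lemma continuous_at_cst (c : R) : continuous_at t (fun=> c).
Proof. exact: cvg_cst. Qed.

Lemma continuous_at_add f g : continuous_at t f -> continuous_at t g ->
  continuous_at t (fun s => f s + g s).
Proof. exact: continuousD. Qed.

Lemma continuous_at_opp f : continuous_at t f ->
  continuous_at t (fun s => - f s).
Proof. exact: continuousN. Qed.

Lemma continuous_at_mul f g : continuous_at t f -> continuous_at t g ->
  continuous_at t (fun s => f s * g s).
Proof. exact: continuousM. Qed.

Lemma continuous_at_inv f : f t != 0 -> continuous_at t f ->
  continuous_at t (fun s => (f s)^-1).
Proof. by move=> f0 fc; apply: continuousV. Qed.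

Ltac cts := lazymatch goal with
  | |- continuous_at _ (fun _ => ?c) => exact (@continuous_at_cst c)
  | |- continuous_at _ (fun s => @?f s + @?g s) =>
      apply (@continuous_at_add f g); cts
  | |- continuous_at _ (fun s => @?f s * @?g s) =>
      apply (@continuous_at_mul f g); cts
  | |- continuous_at _ (fun s => - @?f s) => apply (@continuous_at_opp f); cts
  | |- continuous_at _ (fun s => Num.sqrt (@?f s)) =>
      apply (@continuous_at_sqrt f); cts
  | |- continuous_at _ (fun s => sin (@?f s)) => apply (@continuous_at_sin f); cts
  | |- continuous_at _ (fun s => cos (@?f s)) => apply (@continuous_at_cos f); cts
  | |- continuous_at _ (fun s => atan (@?f s)) => apply (@continuous_at_atan f); cts
  | |- continuous_at _ (fun s => expR (@?f s)) => apply (@continuous_at_expR f); cts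
  | _ => try assumption
  end.

Lemma continuous_at_rho2 A d f : continuous_at t f ->
  continuous_at t (fun s => rho2 A d (f s)).
Proof. by move=> fc; rewrite /rho2 /block_tr /block_det; cts. Qed.

Lemma continuous_at_sig2 A d f : continuous_at t f ->
  continuous_at t (fun s => sig2 A d (f s)).
Proof. by move=> fc; rewrite /sig2 /block_tr /block_det; cts. Qed.

Lemma continuous_at_gcos f g : continuous_at t f -> continuous_at t g ->
  continuous_at t (fun s => gcos (f s) (g s)).
Proof. by move=> fc gc; rewrite /gcos /cosh; cts. Qed.

Lemma continuous_at_dgcos f g : continuous_at t f -> continuous_at t g ->
  continuous_at t (fun s => dgcos (f s) (g s)).
Proof. by move=> fc gc; rewrite /dgcos /cosh /sinh; cts. Qed.

Lemma continuous_at_planeX A d f g : continuous_at t f -> continuous_at t g ->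
  continuous_at t (fun s => planeX A d (f s) (g s)).
Proof.
move=> fc gc; rewrite /planeX; apply: continuous_at_add.
  by apply: continuous_at_gcos => //; exact: continuous_at_rho2.
by apply/continuous_at_opp/continuous_at_gcos => //; exact: continuous_at_sig2.
Qed.

Lemma continuous_at_planeY A d f g : continuous_at t f -> continuous_at t g ->
  continuous_at t (fun s => planeY A d (f s) (g s)).
Proof.
move=> fc gc; rewrite /planeY; apply: continuous_at_add.
  by apply: continuous_at_dgcos => //; exact: continuous_at_rho2.
by apply/continuous_at_opp/continuous_at_dgcos => //; exact: continuous_at_sig2.
Qed.

Lemma continuous_at_phase f g h : continuous_at t f -> continuous_at t g ->
  continuous_at t h ->
  modulus (f t) (g t) + phase_dot (f t) (g t) (h t) != 0 ->
  continuous_at t (fun s => phase (f s) (g s) (h s)).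
Proof.
move=> fc gc hc nz; rewrite /phase; cts.
- rewrite /phase_cross; cts.
- apply: continuous_at_inv => //; rewrite /modulus /phase_dot.
  by rewrite (_ : (fun s => _) = fun s => Num.sqrt (f s * f s + g s * g s) +
    (- f s * cos (h s) + g s * sin (h s))) //; cts.
Qed.

End Continuity.

Section Facts.
Variables (A : 'M[R]_2) (d : R).
Hypotheses (detA_gt0 : 0 < \det A) (trA_lt0 : \tr A < 0) (d_gt0 : 0 < d).

Lemma det_mx2 : \det A = A 0 0 * A 1 1 - A 0 1 * A 1 0.
Proof.
rewrite (expand_det_row _ 0) big_ord_recl big_ord1 /cofactor !det_mx11 !mxE /=.
rewrite expr0 expr1 mul1r mulN1r mulrN.
by congr (_ * A _ _ - A _ _ * A _ _); exact: val_inj.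
Qed.

Lemma tr_mx2 : \tr A = A 0 0 + A 1 1.
Proof.
rewrite /mxtrace big_ord_recl big_ord1; congr (_ + A _ _); exact: val_inj.
Qed.

Lemma block_detE l : block_det A d l = (l ^+ 2 - \tr A * l + \det A) / d.
Proof. by rewrite det_mx2 tr_mx2 /block_det; ring. Qed.

Lemma block_det_gt0 l : 0 <= l -> 0 < block_det A d l.
Proof.
move=> l0; rewrite block_detE divr_gt0 //.
by rewrite ltr_wpDl // addr_ge0 ?sqr_ge0 // -mulNr mulr_ge0 // oppr_ge0 ltW.
Qed.

Lemma sqrt_block_det_gt0 l : 0 <= l -> 0 < Num.sqrt (block_det A d l).
Proof. by move=> l0; rewrite sqrtr_gt0 block_det_gt0. Qed.

Lemma ltr_block_det l m : 0 <= l -> l < m ->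
  Num.sqrt (block_det A d l) < Num.sqrt (block_det A d m).
Proof.
move=> l0 lm; rewrite ltr_sqrt; last exact/block_det_gt0/ltW/(le_lt_trans l0).
rewrite !block_detE ltr_pM2r ?invr_gt0 // -subr_gt0.
have -> : m ^+ 2 - \tr A * m + \det A - (l ^+ 2 - \tr A * l + \det A) =
  (m - l) * (m + l - \tr A) by ring.
rewrite mulr_gt0 ?subr_gt0 //; apply: lt_le_trans trA_lt0 _.
by rewrite addr_ge0 // ltW // (le_lt_trans l0).
Qed.

Lemma ltr_block_tr l m : l < m -> block_tr A d l < block_tr A d m.
Proof.
move=> lm; rewrite /block_tr; apply: ltrD; first by rewrite ltrD2r.
by rewrite ltr_pM2r ?invr_gt0 // ltrD2r.
Qed.

(** Trace and determinant of [B] both increase on [l >= 0], the latter because [\tr A < 0]. *)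
Lemma rho2_decreasing l m : 0 <= l -> l < m -> rho2 A d m < rho2 A d l.
Proof.
move=> l0 lm; rewrite /rho2.
have := ltr_block_det l0 lm; have := ltr_block_tr lm; lra.
Qed.

Lemma rho2_lt_sig2 l : 0 <= l -> rho2 A d l < sig2 A d l.
Proof. by move=> l0; rewrite /rho2 /sig2; have := sqrt_block_det_gt0 l0; lra. Qed.

(** Translates the two conditions on [d] into the sign of [rho2] at [l = 0]. *)
Lemma rho2_0 : d * rho2 A d 0 = A 1 1 + d * A 0 0 - 2 * Num.sqrt (d * \det A).
Proof.
have -> : rho2 A d 0 = - block_tr A d 0 - 2 * (Num.sqrt (d * \det A) / d).
  rewrite /rho2; congr (_ - 2 * _).
  apply/eqP; rewrite -(@eqrXn2 _ 2) // ?divr_ge0 ?sqrtr_ge0 ?(ltW d_gt0) //; apply/eqP.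
  rewrite sqr_sqrtr ?ltW ?block_det_gt0 // expr_div_n sqr_sqrtr; last first.
    by rewrite ltW // mulr_gt0.
  by rewrite block_detE; field; exact: lt0r_neq0.
by rewrite /block_tr; field; exact: lt0r_neq0.
Qed.

Lemma rho2_0_lt0 : A 1 1 + d * A 0 0 < 2 * Num.sqrt (d * \det A) -> rho2 A d 0 < 0.
Proof. by move=> H; rewrite -(pmulr_rlt0 _ d_gt0) rho2_0 subr_lt0. Qed.

Lemma rho2_0_gt0 : 2 * Num.sqrt (d * \det A) < A 1 1 + d * A 0 0 -> 0 < rho2 A d 0.
Proof. by move=> H; rewrite -(pmulr_rgt0 _ d_gt0) rho2_0 subr_gt0. Qed.

Lemma rho2_root : 0 < rho2 A d 0 -> exists2 l, 0 < l & rho2 A d l = 0.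
Proof.
(* [m] is the zero of [block_tr], where [rho2] reduces to [- 2 sqrt (det B)]; so a root lies between
   0 and [m]. *)
move=> r0; pose m := (A 1 1 + d * A 0 0) / (1 + d).
have d1 : 0 < 1 + d by rewrite addr_gt0.
have m0 : 0 < m.
  rewrite divr_gt0 //; have := mulr_gt0 d_gt0 r0; rewrite rho2_0.
  by have := sqrtr_ge0 (d * \det A); lra.
have rm : rho2 A d m <= 0.
  have -> : rho2 A d m = - (2 * Num.sqrt (block_det A d m)).
    rewrite /rho2 (_ : block_tr A d m = 0) ?oppr0 ?sub0r //.
    by rewrite /block_tr /m; field; rewrite !lt0r_neq0.
  by rewrite oppr_le0 mulr_ge0 ?sqrtr_ge0.
have [||l] := @IVT R (rho2 A d) 0 m 0 (ltW m0).
- apply: continuous_subspaceT => s.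
  by apply: (@continuous_at_rho2 R s A d idfun); exact: cvg_id.
- by rewrite ge_min le_max rm (ltW r0) orbT.
rewrite in_itv /= => /andP[l0 _] rl; exists l => //.
by rewrite lt_def l0 andbT; apply: contraTneq r0 => E; rewrite E in rl; rewrite rl ltxx.
Qed.

Lemma planeX_gt0 x l : 0 <= l -> 0 < x -> rho2 A d l < 0 -> 0 < planeX A d x l.
Proof. by move=> l0 x0 r0; rewrite /planeX subr_gt0 ltr_gcos // rho2_lt_sig2. Qed.

Lemma plane_omega x l : 0 <= l ->
  let c := 2 * Num.sqrt (block_det A d l) in
  c * omega1 (fund A d l 2 x) (fund A d l 3 x) = planeX A d x l /\
  c * omega2 (fund A d l 2 x) (fund A d l 3 x) = planeY A d x l.
Proof.
move=> l0; apply: omega_gcos; first exact: lt0r_neq0.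
exact/ltW/block_det_gt0.
Qed.

Lemma transverse_planeX x l : 0 <= l -> transverse A d x l -> planeX A d x l != 0.
Proof.
move=> l0 /transverse_omega1 o1.
have [<- _] := plane_omega x l0.
by rewrite !mulf_neq0 // lt0r_neq0 // sqrt_block_det_gt0.
Qed.

Lemma calM_W x l : 0 <= l -> (planeX A d x l, planeY A d x l) != (0, 0) ->
  calM (W A d x l).
Proof.
move=> l0 nz.
apply: (calM_span2 (dim_W A d l x) (W_fund A d l x)).
apply: contra nz; rewrite !xpair_eqE => /andP[/eqP o1 /eqP o2].
by have [<- <-] := plane_omega x l0; rewrite o1 o2 !mulr0 eqxx.
Qed.

Local Open Scope complex_scope.

Lemma tau_W x l (N a : R) : 0 <= l -> N != 0 ->
  planeX A d x l = N * cos a -> planeY A d x l = - (N * sin a) ->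
  tau (phi (W A d x l)) = cos (2 * a) +i* sin (2 * a).
Proof.
move=> l0 N0 XE YE.
have [w1 w2] := plane_omega x l0.
rewrite (tau_phi_span2 (dim_W A d l x) (W_fund A d l x) _ w1 w2).
  by rewrite XE YE sqr_sign_polar.
rewrite XE YE xpair_eqE oppr_eq0 !mulf_eq0 (negbTE N0) /=.
apply/negP => /andP[/eqP c0 /eqP s0]; have := cos2Dsin2 a.
by rewrite c0 s0 expr0n addr0 => /eqP; rewrite eq_sym oner_eq0.
Qed.

(** [alpha] is an argument modulo [pi] only, as [N] may be negative; [tau] doubles it, so a total
    change of [n * pi] counts as degree [n]. *)
Lemma index_of_lift delta L linf (alpha : R -> R) (n : int) :
  (forall t : R, 0 <= t <= 4 -> 0 <= (rect_bdry delta L linf t).2) ->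
  {within `[0, 4], continuous alpha} ->
  (forall t : R, 0 <= t <= 4 -> exists2 N : R, N != 0 &
     planeX A d (rect_bdry delta L linf t).1 (rect_bdry delta L linf t).2 =
       N * cos (alpha t) /\
     planeY A d (rect_bdry delta L linf t).1 (rect_bdry delta L linf t).2 =
       - (N * sin (alpha t))) ->
  alpha 4 - alpha 0 = n%:~R * pi ->
  index_is A d delta L linf n.
Proof.
move=> l0 ac aP an; split=> [t|].
  rewrite in_itv /= => t04; have [N N0 [XE YE]] := aP t t04.
  apply: calM_W; first exact: l0.
  rewrite XE YE xpair_eqE oppr_eq0 !mulf_eq0 (negbTE N0) /=.
  apply/negP => /andP[/eqP c0 /eqP s0]; have := cos2Dsin2 (alpha t).
  by rewrite c0 s0 expr0n addr0 => /eqP; rewrite eq_sym oner_eq0.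
exists (fun t => 2 * alpha t); split.
- move=> t; have H := @continuous_at_mul _ t (fun=> 2) alpha (@continuous_at_cst _ t 2) (ac t).
  exact: H.
- move=> t; rewrite in_itv /= => t04; have [N N0 [XE YE]] := aP t t04.
  by rewrite /W_bdry (tau_W _ N0 XE YE) // l0.
- by rewrite -mulrBr an; ring.
Qed.

End Facts.
End PlaneCoordinates.

(** * Degenerate points *)

Section Frequencies.
Context {R : realType}.
Implicit Types (A : 'M[R]_2) (d l x : R).

Lemma pi_decomp x : 0 <= x ->
  exists (n : nat) (y : R), x = y + pi *+ n /\ 0 <= y < pi.
Proof.
move=> x0; have pig := @pi_gt0 R.
have /andP[h1 h2] := truncn_itv (divr_ge0 x0 (ltW pig)).
exists (Num.truncn (x / pi)), (x - pi *+ Num.truncn (x / pi)).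
split; first by rewrite subrK.
rewrite -mulr_natl subr_ge0 -ler_pdivlMr // h1 /=.
by rewrite ltrBlDl -[X in _ < _ + X]mul1r -mulrDl -ltr_pdivrMr // natr1.
Qed.

Lemma sin_eq0_natmul x : 0 < x -> sin x = 0 -> exists2 n : nat, (0 < n)%N & x = n%:R * pi.
Proof.
move=> x0 sx; have [n [y [xE /andP[y0 ypi]]]] := pi_decomp (ltW x0).
have [yz|ynz] := eqVneq y 0.
  exists n; last by rewrite xE yz add0r mulr_natl.
  by rewrite lt0n; apply: contraTneq x0 => n0; rewrite xE yz n0 mulr0n addr0 ltxx.
have sy : 0 < sin y by apply: sin_gt0_pi; rewrite lt_def ynz y0.
have : `|sin x| = `|sin y|.
  rewrite xE; elim: n {xE} => [|n IH]; first by rewrite addr0.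
  by rewrite mulrSr addrA sinDpi normrN.
by rewrite sx normr0 gtr0_norm // => E; rewrite -E ltxx in sy.
Qed.

(** One sine vanishes by the first equation; the cosine of that angle is then nonzero, and the
    second equation kills the other sine. *)
Lemma prod_eq0 (k1 k2 a b : R) : 0 < k1 -> 0 < k2 ->
  prodX a b = 0 -> prodY k1 k2 a b = 0 -> sin a = 0 /\ sin b = 0.
Proof.
move=> k10 k20; have Ea := cos2Dsin2 a; have Eb := cos2Dsin2 b.
rewrite /prodX /prodY => /eqP + /eqP; rewrite !mulf_eq0 pnatr_eq0 /=.
move=> /orP[]/eqP z; rewrite z.
  rewrite mul0r mulr0 addr0 !mulf_eq0 (gt_eqF k10) /= => /orP[/eqP c0|/eqP //].
  by move: Ea; rewrite z c0 expr0n addr0 => /eqP; rewrite eq_sym oner_eq0.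
rewrite mulr0 mulr0 add0r !mulf_eq0 (gt_eqF k20) /= => /orP[/eqP //|/eqP c0].
by move: Eb; rewrite z c0 expr0n addr0 => /eqP; rewrite eq_sym oner_eq0.
Qed.

(** Where [rho2 >= 0], the numbers [k1 >= k2] for which [B] has eigenvalues [- k1^2] and [- k2^2],
    recovered from their sum and difference. *)
Definition freq1 A d l : R := (Num.sqrt (sig2 A d l) + Num.sqrt (rho2 A d l)) / 2.
Definition freq2 A d l : R := (Num.sqrt (sig2 A d l) - Num.sqrt (rho2 A d l)) / 2.

Lemma freqD A d l : freq1 A d l + freq2 A d l = Num.sqrt (sig2 A d l).
Proof. by rewrite /freq1 /freq2; field. Qed.

Lemma freq2_le A d l : freq2 A d l <= freq1 A d l.
Proof.
rewrite /freq1 /freq2 ler_pM2r ?invr_gt0 //.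
by have := sqrtr_ge0 (rho2 A d l); lra.
Qed.

Section Region.
Variables (A : 'M[R]_2) (d : R).
Hypotheses (detA_gt0 : 0 < \det A) (trA_lt0 : \tr A < 0) (d_gt0 : 0 < d).
Variable l : R.
Hypotheses (l0 : 0 <= l) (r0 : 0 <= rho2 A d l).

Lemma freq2_gt0 : 0 < freq2 A d l.
Proof.
have rs := rho2_lt_sig2 detA_gt0 trA_lt0 d_gt0 l0.
by rewrite divr_gt0 // subr_gt0 ltr_sqrt // (le_lt_trans r0).
Qed.

Lemma freq1_gt0 : 0 < freq1 A d l.
Proof. exact: lt_le_trans freq2_gt0 (freq2_le _ _ _). Qed.

Let s0 : 0 <= sig2 A d l.
Proof. exact/ltW/(le_lt_trans r0)/rho2_lt_sig2. Qed.

Lemma freqM : freq1 A d l * freq2 A d l = Num.sqrt (block_det A d l).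
Proof.
have -> : freq1 A d l * freq2 A d l =
    (Num.sqrt (sig2 A d l) ^+ 2 - Num.sqrt (rho2 A d l) ^+ 2) / 4.
  by rewrite /freq1 /freq2; field.
by rewrite !sqr_sqrtr // /sig2 /rho2; field.
Qed.

Lemma freq_sqrD : freq1 A d l ^+ 2 + freq2 A d l ^+ 2 = - block_tr A d l.
Proof.
have -> : freq1 A d l ^+ 2 + freq2 A d l ^+ 2 =
    (Num.sqrt (sig2 A d l) ^+ 2 + Num.sqrt (rho2 A d l) ^+ 2) / 2.
  by rewrite /freq1 /freq2; field.
by rewrite !sqr_sqrtr // /sig2 /rho2; field.
Qed.

Let freq_split x : Num.sqrt (rho2 A d l) * x = freq1 A d l * x - freq2 A d l * x /\
  Num.sqrt (sig2 A d l) * x = freq1 A d l * x + freq2 A d l * x.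
Proof. by rewrite /freq1 /freq2; split; field. Qed.

Lemma planeX_prod x : planeX A d x l = prodX (freq1 A d l * x) (freq2 A d l * x).
Proof.
rewrite /planeX !gcosE //; have [-> ->] := freq_split x.
by rewrite cosB cosD /prodX; ring.
Qed.

Lemma planeY_prod x : planeY A d x l =
  prodY (freq1 A d l) (freq2 A d l) (freq1 A d l * x) (freq2 A d l * x).
Proof.
rewrite /planeY !dgcosE //; have [-> ->] := freq_split x.
by rewrite sinB sinD /prodY /freq1 /freq2; field.
Qed.

Lemma degenerate_freq x : 0 < x -> planeX A d x l = 0 -> planeY A d x l = 0 ->
  exists n m : nat, [/\ (0 < n)%N, (0 < m)%N, freq1 A d l * x = n%:R * pi &
    freq2 A d l * x = m%:R * pi].
Proof.
move=> x0; rewrite planeX_prod planeY_prod => X0 Y0.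
have f1 := freq1_gt0; have f2 := freq2_gt0.
have [sa sb] := prod_eq0 f1 f2 X0 Y0.
have [n n0 nE] := sin_eq0_natmul (mulr_gt0 f1 x0) sa.
have [m m0 mE] := sin_eq0_natmul (mulr_gt0 f2 x0) sb.
by exists n, m.
Qed.

(** The length cancels: [n m (k1^2 + k2^2) = (n^2 + m^2) k1 k2] depends only on the ratio
    [k1 : k2 = n : m]. *)
Lemma resonance x (n m : nat) : 0 < x ->
  freq1 A d l * x = n%:R * pi -> freq2 A d l * x = m%:R * pi ->
  n%:R * m%:R * - block_tr A d l =
  (n%:R ^+ 2 + m%:R ^+ 2) * Num.sqrt (block_det A d l).
Proof.
move=> x0 nE mE; rewrite -freqM -freq_sqrD.
have n1 : freq1 A d l = n%:R * (pi / x) by rewrite mulrA -nE mulfK // gt_eqF.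
have m1 : freq2 A d l = m%:R * (pi / x) by rewrite mulrA -mE mulfK // gt_eqF.
by rewrite n1 m1; ring.
Qed.

End Region.

(** * Countability of the exceptional coefficients and lengths *)

Section Exceptional.
Variable A : 'M[R]_2.
Hypotheses (detA_gt0 : 0 < \det A) (trA_lt0 : \tr A < 0).

(** The set [Delta_*], given by the resonance relation at [l = 0] multiplied by [d]. *)
Definition resonant : set R := [set d | 0 < d /\ exists n m : nat,
  [/\ (0 < n)%N, (0 < m)%N & n%:R * m%:R * (A 1 1 + d * A 0 0) =
    (n%:R ^+ 2 + m%:R ^+ 2) * Num.sqrt (d * \det A)]].

Lemma countable_roots (p : {poly R}) : p != 0 -> countable [set x | root p x].
Proof.
move=> p0; apply: finite_set_countable; apply: (@sub_finite_set _ _ [set` rootsR p]).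
  by move=> x /= px; rewrite -(roots_on_rootsR p0) in_itv.
exact: finite_seq.
Qed.

Lemma countable_resonant : countable resonant.
Proof.
(* For fixed [n, m] the relation is a polynomial equation in [sqrt d]; [F] shifts the indices by one
   to make both positive. *)
pose q (n m : nat) : {poly R} := (n%:R * m%:R * A 0 0) *: 'X^2
  - ((n%:R ^+ 2 + m%:R ^+ 2) * Num.sqrt (\det A)) *: 'X + (n%:R * m%:R * A 1 1)%:P.
pose F (nm : nat * nat) : set R :=
  (fun e => e ^+ 2) @` [set e | root (q nm.1.+1 nm.2.+1) e].
apply: (@sub_countable _ _ _ (\bigcup_(nm in setT) F nm)).
  apply: subset_card_le => d [d0 [[|n] [[|m] [//= n0 m0 E]]]].
  exists (n, m) => //; exists (Num.sqrt d); last by rewrite sqr_sqrtr // ltW.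
  rewrite /= /root.
  have -> : (q n.+1 m.+1).[Num.sqrt d] =
      n.+1%:R * m.+1%:R * (A 1 1 + Num.sqrt d ^+ 2 * A 0 0)
      - (n.+1%:R ^+ 2 + m.+1%:R ^+ 2) * (Num.sqrt d * Num.sqrt (\det A)).
    rewrite /q !(hornerD, hornerN, hornerZ, hornerXn, hornerX, hornerC).
    ring.
  by rewrite sqr_sqrtr ?ltW // E sqrtrM ?(ltW d0) // subrr.
apply: bigcup_countable => //= -[n m] _.
apply: (sub_countable (card_image_le _ _)) => /=.
(* The linear coefficient is nonzero because [\det A > 0], whereas [A 0 0] or [A 1 1] may vanish. *)
apply: countable_roots; apply/eqP => /(congr1 (fun p : {poly R} => p`_1)).
rewrite /q !(coefD, coefN, coefZ, coefXn, coefX, coefC, coef0) /=.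
rewrite mulr0 sub0r mulr1 addr0 => /eqP.
rewrite oppr_eq0 mulf_eq0 gt_eqF /=; last first.
  by rewrite ltr_wpDr ?sqr_ge0 // exprn_gt0 // ltr0n.
by rewrite gt_eqF // sqrtr_gt0.
Qed.

Lemma nonresonant d x : 0 < d -> 0 < rho2 A d 0 -> ~ resonant d -> 0 < x ->
  (planeX A d x 0, planeY A d x 0) != (0, 0).
Proof.
move=> d0 r0 nd x0; apply/negP; rewrite xpair_eqE => /andP[/eqP X0 /eqP Y0].
have [n [m [n0 m0 nE mE]]] :=
  degenerate_freq detA_gt0 trA_lt0 d0 (lexx 0) (ltW r0) x0 X0 Y0.
apply: nd; split=> //; exists n, m; split=> //.
have E := resonance detA_gt0 trA_lt0 d0 (lexx 0) (ltW r0) x0 nE mE.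
have tE : A 1 1 + d * A 0 0 = d * - block_tr A d 0.
  by rewrite /block_tr; field; exact: lt0r_neq0.
have sE : Num.sqrt (d * \det A) = d * Num.sqrt (block_det A d 0).
  have := rho2_0 detA_gt0 trA_lt0 d0; rewrite tE /rho2; lra.
by rewrite tE sE mulrCA E mulrCA.
Qed.

Variable d : R.
Hypothesis d_gt0 : 0 < d.

(** Lengths whose vertical line meets a degenerate point; where [rho2 < 0], [planeX] is positive, so
    only [rho2 >= 0] is recorded. *)
Definition bad_length : set R := [set x | 0 < x /\ exists l,
  [/\ 0 <= l, 0 <= rho2 A d l, planeX A d x l = 0 & planeY A d x l = 0]].

Lemma countable_bad_length : countable bad_length.
Proof.
pose F (nm : nat * nat) : set R := [set x | 0 < x /\ exists l,
  [/\ 0 <= l, 0 <= rho2 A d l, (0 < nm.1)%N /\ (0 < nm.2)%N,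
      freq1 A d l * x = nm.1%:R * pi & freq2 A d l * x = nm.2%:R * pi]].
apply: (@sub_countable _ _ _ (\bigcup_(nm in setT) F nm)).
  apply: subset_card_le => x [x0 [l [l0 r0 X0 Y0]]].
  have [n [m [n0 m0 nE mE]]] := degenerate_freq detA_gt0 trA_lt0 d_gt0 l0 r0 x0 X0 Y0.
  by exists (n, m) => //; split=> //; exists l.
apply: bigcup_countable => //= -[n m] _.
(* In the resonance relation the left side strictly decreases in [l] and the right side strictly
   increases, so [n] and [m] determine [l], and then the length. *)
have key x y l k : 0 < x -> 0 < y -> 0 <= l -> l < k -> 0 <= rho2 A d l ->
    0 <= rho2 A d k -> (0 < n)%N -> (0 < m)%N ->
    freq1 A d l * x = n%:R * pi -> freq2 A d l * x = m%:R * pi ->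
    freq1 A d k * y = n%:R * pi -> freq2 A d k * y = m%:R * pi -> False.
  move=> x0 y0 l0 lk rl rk n0 m0 nl ml nk mk.
  have k0 : 0 <= k by rewrite ltW // (le_lt_trans l0).
  have El := resonance detA_gt0 trA_lt0 d_gt0 l0 rl x0 nl ml.
  have Ek := resonance detA_gt0 trA_lt0 d_gt0 k0 rk y0 nk mk.
  have tlt := ltr_block_tr A d_gt0 lk.
  have dlt := ltr_block_det detA_gt0 trA_lt0 d_gt0 l0 lk.
  have nm0 : 0 < n%:R * m%:R :> R by rewrite mulr_gt0 // ltr0n.
  have nm1 : 0 < n%:R ^+ 2 + m%:R ^+ 2 :> R.
    by rewrite ltr_wpDr ?sqr_ge0 // exprn_gt0 // ltr0n.
  have h1 : n%:R * m%:R * - block_tr A d k < n%:R * m%:R * - block_tr A d l.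
    by rewrite ltr_pM2l // ltrN2.
  have : (n%:R ^+ 2 + m%:R ^+ 2) * Num.sqrt (block_det A d l) <
      (n%:R ^+ 2 + m%:R ^+ 2) * Num.sqrt (block_det A d k) by rewrite ltr_pM2l.
  by rewrite -El -Ek ltNge ltW.
have [[x Fx]|nF] := pselect (exists x, F (n, m) x); last first.
  by rewrite (_ : F _ = set0) //; apply/seteqP; split=> // x Fx; apply: nF; exists x.
apply: (sub_countable (subset_card_le (B := [set x]) _)); last exact: countable1.
case: Fx => /= x0 [l [l0 rl [n0 m0] nl ml]] y [/= y0 [k [k0 rk _ nk mk]]].
have lk : l = k.
  have [lk|kl|//] := ltgtP l k.
    by case: (key x y l k).
  by case: (key y x k l).
apply: (mulfI (lt0r_neq0 (freq1_gt0 detA_gt0 trA_lt0 d_gt0 k0 rk))).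
by rewrite nk -{1}lk nl.
Qed.

End Exceptional.

(** A countable set has Lebesgue measure zero, the interval does not. *)
Lemma itv_not_countable (S : set R) (a b : R) : countable S -> a < b ->
  exists2 x, a < x < b & ~ S x.
Proof.
move=> cS ab; apply: contrapT => nx.
have cI : countable (`]a, b[%classic : set R).
  apply: (sub_countable (subset_card_le (B := S) _)) => // x /=.
  rewrite in_itv /= => xab; apply: contrapT => Sx; apply: nx; by exists x.
have := countable_lebesgue_measure0 cI.
rewrite lebesgue_measure_itv /= lte_fin ab => /eqP.
by rewrite -EFinB eqe subr_eq0 gt_eqF.
Qed.

(** Compactness of the segment makes the neighbourhood of [x] uniform in [l]. *)
Lemma open_forall_segment (f : R -> R -> R) (a b : R) :
  (forall p : R * R, continuous_at p (fun q : R * R => f q.2 q.1)) ->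
  open [set x | forall l, a <= l <= b -> f x l != 0].
Proof.
move=> fc; rewrite openE => x Vx.
have /compact_near_coveringP nc := @segment_compact R a b.
have H : \forall y \near x, `[a, b]%classic `<=` [set l | f y l != 0].
  apply: (nc R (nbhs x) (fun y l => f y l != 0)) => l lab.
  have := fc (l, x); rewrite /continuous_at /= => cf.
  have f0 : f x l != 0 by apply: Vx; move: lab; rewrite /= in_itv.
  have : nbhs (f x l) [set z | z != 0].
    by apply: open_nbhs_nbhs; split=> //; exact: open_neq0.
  by move/cf.
apply: filterS H => y H l lab.
by apply: H; rewrite /= in_itv.
Qed.

End Frequencies.

(** * The index *)

Section Boundary.
Context {R : realType}.
Implicit Types (a b h t : R).

(** Truncation to [[0, 1]]; it turns the piecewise path [rect_bdry] into formulas whose continuity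
    needs no case distinction. *)
Definition clamp t : R := Num.max 0 (Num.min 1 t).

Definition bdryx a b t : R := a + (b - a) * (clamp t - clamp (t - 2)).
Definition bdryl h t : R := h * (clamp (t - 1) - clamp (t - 3)).

Lemma clamp_le0 t : t <= 0 -> clamp t = 0.
Proof. by move=> t0; rewrite /clamp min_r ?max_l //; lra. Qed.

Lemma clamp_ge1 t : 1 <= t -> clamp t = 1.
Proof. by move=> t1; rewrite /clamp min_l // max_r. Qed.

Lemma clamp_id t : 0 <= t <= 1 -> clamp t = t.
Proof. by move=> /andP[t0 t1]; rewrite /clamp min_r // max_r. Qed.

Lemma le_clamp s t : s <= t -> clamp s <= clamp t.
Proof.
move=> st; rewrite /clamp ge_max; apply/andP; split; first by rewrite le_max lexx.
rewrite le_max; apply/orP; right; rewrite le_min ge_min lexx /=.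
by rewrite ge_min st orbT.
Qed.

Lemma bdryx_ge a b t : a <= b -> a <= bdryx a b t.
Proof.
move=> ab; rewrite lerDl mulr_ge0 ?subr_ge0 //.
by apply: le_clamp; rewrite gerBl.
Qed.

Lemma bdryl_ge0 h t : 0 <= h -> 0 <= bdryl h t.
Proof.
move=> h0; rewrite mulr_ge0 // subr_ge0; apply: le_clamp.
lra.
Qed.

Lemma bdry_closed a b h : bdryx a b 4 = bdryx a b 0 /\ bdryl h 4 = bdryl h 0.
Proof.
have c1 t : 1 <= t -> clamp t = 1 by exact: clamp_ge1.
have c0 t : t <= 0 -> clamp t = 0 by exact: clamp_le0.
rewrite /bdryx /bdryl (c1 4) ?(c1 (4 - 2)) ?(c1 (4 - 1)) ?(c1 (4 - 3)); [|lra..].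
rewrite (c0 0) ?(c0 (0 - 2)) ?(c0 (0 - 1)) ?(c0 (0 - 3)); [|lra..].
by rewrite !subrr.
Qed.

Lemma rect_bdryE a b h t : 0 <= t <= 4 -> rect_bdry a b h t = (bdryx a b t, bdryl h t).
Proof.
move=> /andP[t0 t4]; rewrite /rect_bdry /bdryx /bdryl.
have [t1|t1] := leP t 1.
  rewrite (@clamp_id t) ?t0 // !clamp_le0; [|lra..].
  by congr (_, _); ring.
have [t2|t2] := leP t 2.
  rewrite (@clamp_ge1 t) ?(ltW t1) // (@clamp_id (t - 1)); last lra.
  rewrite !clamp_le0; [|lra..].
  by congr (_, _); ring.
have [t3|t3] := leP t 3.
  rewrite (@clamp_ge1 t); last lra.
  rewrite (@clamp_ge1 (t - 1)); last lra.
  rewrite (@clamp_id (t - 2)); last lra.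
  rewrite clamp_le0; last lra.
  by congr (_, _); ring.
rewrite (@clamp_ge1 t); last lra.
rewrite (@clamp_ge1 (t - 1)); last lra.
rewrite (@clamp_ge1 (t - 2)); last lra.
rewrite clamp_id; last lra.
by congr (_, _); ring.
Qed.

Lemma continuous_at_clamp (f : R -> R) t : continuous_at t f ->
  continuous_at t (fun s => clamp (f s)).
Proof.
move=> fc; rewrite /clamp.
apply: (@continuous_max _ _ (fun=> 0) (fun s => Num.min 1 (f s))); first exact: cvg_cst.
by apply: (@continuous_min _ _ (fun=> 1) f) => //; exact: cvg_cst.
Qed.

Lemma continuous_at_shift c t : continuous_at t (fun s : R => s - c).
Proof.
by apply: continuous_at_add; [exact: cvg_id|exact: continuous_at_cst].
Qed.

Lemma continuous_at_bdryx a b t : continuous_at t (bdryx a b).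
Proof.
apply: continuous_at_add; first exact: continuous_at_cst.
apply: continuous_at_mul; first exact: continuous_at_cst.
apply: continuous_at_add; first by apply: continuous_at_clamp; exact: cvg_id.
by apply: continuous_at_opp; apply: continuous_at_clamp; exact: continuous_at_shift.
Qed.

Lemma continuous_at_bdryl h t : continuous_at t (bdryl h).
Proof.
apply: continuous_at_mul; first exact: continuous_at_cst.
apply: continuous_at_add.
  by apply: continuous_at_clamp; exact: continuous_at_shift.
by apply: continuous_at_opp; apply: continuous_at_clamp; exact: continuous_at_shift.
Qed.

Lemma within_glue (f g : R -> R) a c b : a <= c -> c <= b ->
  (forall t, a <= t <= c -> continuous_at t f) ->
  (forall t, c <= t <= b -> continuous_at t g) -> f c = g c ->
  {within `[a, b], continuous (fun t => if t <= c then f t else g t)}.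
Proof.
move=> ac cb fc gc fgc.
have -> : `[a, b]%classic = `[a, c] `|` `[c, b].
  apply/seteqP; split=> t /=; rewrite !in_itv /=.
    move=> /andP[ta tb]; have [tc|tc] := leP t c; first by left; rewrite ta.
    by right; rewrite ltW.
  by case=> /andP[h1 h2]; apply/andP; split=> //; lra.
apply: withinU_continuous; [exact: itv_closed|exact: itv_closed|..].
  apply: (subspace_eq_continuous (f := f)).
    by move=> t; rewrite inE /= in_itv /= => /andP[_ tc]; rewrite /from_subspace tc.
  by apply: continuous_in_subspaceT => t; rewrite inE /= in_itv /=; exact: fc.
apply: (subspace_eq_continuous (f := g)).
  move=> t; rewrite inE /= in_itv /= => /andP[ct _]; rewrite /from_subspace.
  by case: ifPn => // tc; have -> : t = c by apply/eqP; rewrite eq_le tc.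
by apply: continuous_in_subspaceT => t; rewrite inE /= in_itv /=; exact: gc.
Qed.

End Boundary.

Section PhaseShift.
Context {R : realType}.

Lemma phase_periodic (X Y t : R) (n : nat) :
  phase X Y (t + pi *+ 2 *+ n) = phase X Y t + pi *+ 2 *+ n.
Proof.
rewrite /phase /phase_cross /phase_dot.
by rewrite !(periodicn (@cosD2pi R)) !(periodicn (@sinD2pi R)); ring.
Qed.

Lemma prod_shift (k y : R) (n : nat) :
  prodX (y + pi *+ n) (y + pi *+ n) = prodX y y /\
  prodY k k (y + pi *+ n) (y + pi *+ n) = prodY k k y y.
Proof.
elim: n => [|n [IHX IHY]]; first by rewrite mulr0n addr0.
rewrite -IHX -IHY mulrSr addrA /prodX /prodY sinDpi cosDpi.
by split; ring.
Qed.

(** Shifting [y] by [pi *+ n] preserves [prodX] and [prodY] and moves the branch by [n] turns;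
    [phase_base] supplies one more. *)
Lemma phase_shift (k y : R) (n : nat) : 0 < k -> 0 < y < pi ->
  let a := y + pi *+ n in
  phase (prodX a a) (prodY k k a a) (a + a) =
  - atan (prodY k k a a / prodX a a) + pi *+ 2 *+ n.+1.
Proof.
move=> k0 y0 a; have [-> ->] := prod_shift k y n.
have -> : a + a = y + y + pi *+ 2 *+ n by rewrite /a; ring.
rewrite (phase_periodic (prodX y y) (prodY k k y y) (y + y) n).
rewrite (phase_base k0 k0 y0 y0). rewrite (mulrS (pi *+ 2) n).
move: (atan _) (pi *+ 2 *+ n) => u v; rewrite mulr_natl.
by rewrite [RHS]addrA [- u + _]addrC.
Qed.

End PhaseShift.

Section Index.
Context {R : realType}.
Variables (A : 'M[R]_2) (d : R).
Hypotheses (detA_gt0 : 0 < \det A) (trA_lt0 : \tr A < 0) (d_gt0 : 0 < d).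
Implicit Types (x l L : R).

Lemma rho2_le0 l : rho2 A d 0 < 0 -> 0 <= l -> rho2 A d l < 0.
Proof.
move=> r0; rewrite le_eqVlt => /orP[/eqP <- //|l0].
exact: lt_trans (rho2_decreasing detA_gt0 trA_lt0 d_gt0 (lexx 0) l0) r0.
Qed.

Lemma index_zero_of_rho2 L : 0 < L -> rho2 A d 0 < 0 -> index_zero A d L.
Proof.
move=> L0 r0 delta linf [h0 _ /andP[de0 deL] _].
pose X t := planeX A d (bdryx delta L t) (bdryl linf t).
pose Y t := planeY A d (bdryx delta L t) (bdryl linf t).
(* Positivity along the whole boundary makes one arctangent a global argument, which returns to its
   initial value. *)
have X0 t : 0 < X t.
  have l0 := bdryl_ge0 t (ltW h0).
  apply: planeX_gt0 => //; last exact: rho2_le0.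
  exact: lt_le_trans de0 (bdryx_ge _ (ltW deL)).
apply: (@index_of_lift _ _ _ detA_gt0 trA_lt0 d_gt0 _ _ _ (fun t => - atan (Y t / X t))).
- by move=> t t04; rewrite rect_bdryE //; exact/bdryl_ge0/ltW.
- apply: continuous_in_subspaceT => t; rewrite inE /= in_itv /= => t04.
  apply/continuous_at_opp/continuous_at_atan/continuous_at_mul.
    by apply: continuous_at_planeY; [exact: continuous_at_bdryx|exact: continuous_at_bdryl].
  apply: continuous_at_inv; first by rewrite gt_eqF // X0.
  by apply: continuous_at_planeX; [exact: continuous_at_bdryx|exact: continuous_at_bdryl].
- move=> t t04; rewrite rect_bdryE //=.
  have [N0 XE YE] := atan_polar (Y t) (lt0r_neq0 (X0 t)).
  by exists (X t / cos (atan (Y t / X t))).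
- have [E4x E4l] := bdry_closed delta L linf.
  by rewrite /X /Y E4x E4l subrr mul0r.
Qed.

Variable lstar : R.
Hypotheses (lstar_gt0 : 0 < lstar) (rho2_lstar : rho2 A d lstar = 0).

Lemma rho2_ge0 l : 0 <= l <= lstar -> 0 <= rho2 A d l.
Proof.
move=> /andP[l0]; rewrite le_eqVlt => /orP[/eqP ->|ll]; first by rewrite rho2_lstar.
by rewrite -rho2_lstar ltW // rho2_decreasing.
Qed.

Lemma rho2_gt_lstar l : lstar < l -> rho2 A d l < 0.
Proof. by move=> ll; rewrite -rho2_lstar rho2_decreasing // ltW. Qed.

(** At [lstar] the frequencies differ by [sqrt rho2 = 0]; [k] is their common value. *)
Let k := freq1 A d lstar.

Lemma freq2_lstar : freq2 A d lstar = k.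
Proof. by rewrite /k /freq2 /freq1 rho2_lstar sqrtr0 subr0 addr0. Qed.

Let k_gt0 : 0 < k.
Proof. by apply: freq1_gt0 => //; [exact: ltW|rewrite rho2_lstar]. Qed.

Lemma planeX_lstar x : planeX A d x lstar = prodX (k * x) (k * x).
Proof. by rewrite planeX_prod ?freq2_lstar ?(ltW lstar_gt0) ?rho2_lstar. Qed.

Lemma planeY_lstar x : planeY A d x lstar = prodY k k (k * x) (k * x).
Proof. by rewrite planeY_prod ?freq2_lstar ?(ltW lstar_gt0) ?rho2_lstar. Qed.

Lemma index_nonzero_of_length L : 0 < rho2 A d 0 -> ~ resonant A d ->
  pi / k < L -> ~ bad_length A d L -> index_nonzero A d L.
Proof.
move=> r0 nres kL nbad delta linf [h0 trtop /andP[de0 deL] trleft].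
have pig := @pi_gt0 R; have L0 := lt_trans de0 deL.
have f10 : 0 < freq1 A d 0 by apply: freq1_gt0 => //; exact: ltW.
have f20 : 0 < freq2 A d 0 by apply: freq2_gt0 => //; exact: ltW.
(* Otherwise [planeX] would vanish at [l = 0] for some [x <= delta], against the choice of [delta].
   So both angles are below [pi] at the starting corner. *)
have f1d : freq1 A d 0 * delta < pi.
  rewrite ltNge; apply/negP => pid.
  have tr : transverse A d (pi / freq1 A d 0) 0.
    apply: trleft; last by rewrite lexx ltW.
    by rewrite divr_gt0 //= ler_pdivrMr // mulrC.
  have := transverse_planeX detA_gt0 trA_lt0 d_gt0 (lexx 0) tr.
  have e : freq1 A d 0 * (pi / freq1 A d 0) = pi by rewrite mulrC divfK // gt_eqF.
  by rewrite planeX_prod ?(ltW r0) // e /prodX sinpi mul0r mulr0 eqxx.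
have f2d : freq2 A d 0 * delta < pi.
  by apply: le_lt_trans f1d; rewrite ler_pM2r // freq2_le.
(* Otherwise [(pi / k, lstar)], where [planeX] vanishes, would lie in the region where [linf]
   guarantees transversality. So the right side passes through [lstar]. *)
have lh : lstar < linf.
  rewrite ltNge; apply/negP => hl.
  have tr : transverse A d (pi / k) lstar.
    by apply: trtop => //; rewrite divr_gt0 //= ltW.
  have := transverse_planeX detA_gt0 trA_lt0 d_gt0 (ltW lstar_gt0) tr.
  have e : k * (pi / k) = pi by rewrite mulrC divfK // gt_eqF.
  by rewrite planeX_lstar e /prodX sinpi mul0r mulr0 eqxx.
have kL0 : pi < k * L by rewrite mulrC -ltr_pdivrMr.
(* [n] counts the multiples of [pi] up to [k * L]; a zero remainder would make [L] a bad length,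
   degenerate at [lstar]. *)
have [n [y [kLE /andP[y0 ypi]]]] := pi_decomp (ltW (lt_trans pig kL0)).
have n0 : (0 < n)%N.
  by rewrite lt0n; apply: contraTneq kL0 => n0; rewrite kLE n0 mulr0n addr0 -leNgt ltW.
have {}y0 : 0 < y.
  rewrite lt_def y0 andbT; apply/eqP => yz; apply: nbad; split=> //; exists lstar.
  have [PX PY] := prod_shift k y n.
  split; rewrite ?rho2_lstar ?(ltW lstar_gt0) // ?planeX_lstar ?planeY_lstar kLE.
    by rewrite PX yz /prodX sin0 mul0r mulr0.
  by rewrite PY yz /prodY sin0 !mulr0 mul0r !mulr0 addr0 mulr0.
have XL : planeX A d L lstar != 0.
  rewrite planeX_lstar kLE; have [-> _] := prod_shift k y n.
  by rewrite /prodX gt_eqF // !mulr_gt0 // sin_gt0_pi // y0.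
(* The time at which the path, on its second side, reaches [(L, lstar)]. *)
pose tstar := 1 + lstar / linf.
have ts1 : 1 < tstar by rewrite ltrDl divr_gt0.
have ts2 : tstar < 2 by rewrite /tstar -[ltRHS](natr1 1) ltrD2l ltr_pdivrMr // mul1r.
pose x t := bdryx delta L t; pose l t := bdryl linf t.
pose X t := planeX A d (x t) (l t); pose Y t := planeY A d (x t) (l t).
(* [f1] serves the bottom side and the right side up to [lstar], with reference angle
   [sqrt sig2 * x = a + b]; [f2] serves the rest, its constant being chosen to agree with [f1] at
   [tstar]. *)
pose f1 t := phase (X t) (Y t) (Num.sqrt (sig2 A d (l t)) * x t).
pose f2 t := - atan (Y t / X t) + pi *+ 2 *+ n.+1.
have xlE t : 0 <= t <= 4 -> (x t, l t) = rect_bdry delta L linf t.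
  by move=> t04; rewrite rect_bdryE.
have l_ge0 t : 0 <= t <= 4 -> 0 <= l t by move=> _; exact/bdryl_ge0/ltW.
(* Degenerate points are excluded by nonresonance of [d] on the bottom side and by the choice of [L]
   on the right side. *)
have good1 t : 0 <= t <= tstar ->
    [/\ 0 <= l t, 0 <= rho2 A d (l t) & (X t, Y t) != (0, 0)].
  move=> /andP[t0 tt]; have t04 : 0 <= t <= 4 by rewrite t0; lra.
  have := xlE t t04; rewrite /rect_bdry /X /Y; case: ifPn => [t1 [-> ->]|].
    split; [by []|exact: ltW|apply: nonresonant => //].
    by rewrite ltr_wpDr // mulr_ge0 // subr_ge0 ltW.
  rewrite -ltNge => t1; rewrite (_ : t <= 2); last by lra.
  case=> -> ->.
  have l0 : 0 <= (t - 1) * linf by rewrite mulr_ge0 ?ltW // subr_gt0.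
  have ll : (t - 1) * linf <= lstar.
    by rewrite -ler_pdivlMr // lerBlDl.
  have rl : 0 <= rho2 A d ((t - 1) * linf) by apply: rho2_ge0; rewrite l0.
  split=> //; apply/negP; rewrite xpair_eqE => /andP[/eqP X0 /eqP Y0].
  by apply: nbad; split=> //; exists ((t - 1) * linf).
(* The reasons are [XL] at [lstar], [rho2 < 0] above it and on the top side, and transversality on
   the left side. *)
have good2 t : tstar <= t <= 4 -> X t != 0.
  move=> /andP[tt t4]; have t04 : 0 <= t <= 4 by rewrite t4 andbT; lra.
  have := xlE t t04; rewrite /rect_bdry /X leNgt (lt_le_trans ts1 tt) /=.
  have deltaX z : 0 <= z <= linf -> planeX A d delta z != 0.
    move=> hz; have /andP[z0 _] := hz.
    by apply: transverse_planeX => //; apply: trleft; rewrite ?de0 ?lexx.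
  case: ifPn => [t2 [-> ->]|].
    have : lstar <= (t - 1) * linf by rewrite -ler_pdivrMr // lerBrDl.
    rewrite le_eqVlt => /orP[/eqP <- //|ll].
    by rewrite gt_eqF // planeX_gt0 // ?rho2_gt_lstar // ltW // (lt_trans lstar_gt0).
  rewrite -ltNge => t2; case: ifPn => [t3 [-> ->]|].
    rewrite gt_eqF // planeX_gt0 // ?rho2_gt_lstar // ?(ltW h0) //.
    have : (t - 2) * (L - delta) <= 1 * (L - delta) by rewrite ler_wpM2r //; lra.
    lra.
  rewrite -ltNge => t3 [-> ->]; apply: deltaX.
  have h4 : 0 <= (4 - t) * linf by apply: mulr_ge0; [lra|exact: ltW].
  have : (4 - t) * linf <= 1 * linf by apply: ler_wpM2r; [exact: ltW|lra].
  by rewrite mul1r h4.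
have NP t : 0 <= t <= tstar ->
    0 < modulus (X t) (Y t) + phase_dot (X t) (Y t) (Num.sqrt (sig2 A d (l t)) * x t).
  move=> ht; have [l0 rl nz] := good1 t ht.
  move: nz; rewrite /X /Y planeX_prod // planeY_prod // -freqD mulrDl.
  by apply: prod_phase_gt0; [exact: freq1_gt0|exact: freq2_gt0].
have match_start : f1 0 = pi *+ 2 - atan (Y 0 / X 0).
  have [E0 E1] : x 0 = delta /\ l 0 = 0.
    have h04 : 0 <= (0 : R) <= 4 by rewrite lexx /=.
    by have := xlE 0 h04; rewrite /rect_bdry ler01 mul0r addr0 => -[].
  rewrite /f1 /X /Y E0 E1 planeX_prod ?(ltW r0) // planeY_prod ?(ltW r0) // -freqD mulrDl.
  rewrite phase_base //; first by rewrite mulr_natl.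
    by rewrite f1d mulr_gt0.
  by rewrite f2d mulr_gt0.
have match_mid : f1 tstar = f2 tstar.
  have [E0 E1] : x tstar = L /\ l tstar = lstar.
    have h04 : 0 <= tstar <= 4 by apply/andP; split; lra.
    have := xlE tstar h04; rewrite /rect_bdry leNgt ts1 /= (ltW ts2).
    by rewrite /tstar addrAC subrr add0r divfK ?gt_eqF // => -[].
  rewrite /f1 /f2 /X /Y E0 E1 planeX_lstar planeY_lstar -freqD freq2_lstar mulrDl -/k kLE.
  by rewrite phase_shift // y0.
have [E4x E4l] : x 4 = x 0 /\ l 4 = l 0 by exact: bdry_closed.
have cx t : continuous_at t x by exact: continuous_at_bdryx.
have cl t : continuous_at t l by exact: continuous_at_bdryl.
have cX t : continuous_at t X by exact: continuous_at_planeX.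
have cY t : continuous_at t Y by exact: continuous_at_planeY.
(* [f1] starts one turn above [- atan (Y / X)] and [f2] ends [n.+1] turns above it; the change is
   [2 * n * pi]. *)
exists (n.*2)%:Z; first by rewrite -lt0n double_gt0.
apply: (@index_of_lift _ _ _ detA_gt0 trA_lt0 d_gt0 _ _ _
  (fun t => if t <= tstar then f1 t else f2 t)).
- by move=> t t04; rewrite -xlE //= l_ge0.
- apply: within_glue => //; [lra|lra| |].
    move=> t ht; apply: continuous_at_phase => //; last by rewrite gt_eqF // NP.
    apply: continuous_at_mul => //; apply: continuous_at_sqrt.
    exact: continuous_at_sig2.
  move=> t ht; apply: continuous_at_add; last exact: continuous_at_cst.
  apply/continuous_at_opp/continuous_at_atan/continuous_at_mul => //.
  by apply: continuous_at_inv => //; exact: good2.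
- move=> t t04; rewrite -xlE //= -/(X t) -/(Y t); have /andP[t0 t4] := t04.
  case: ifPn => [tt|].
    have np : 0 < _ := NP t _; rewrite t0 tt in np; have {}np := np isT.
    exists (modulus (X t) (Y t)); last exact: phase_polar.
    by rewrite gt_eqF // (modulus_gt0 np).
  rewrite -ltNge => tt.
  have Xt : X t != 0 by apply: good2; rewrite t4 ltW.
  have [N0 XE YE] := atan_polar (Y t) Xt.
  exists (X t / cos (atan (Y t / X t))) => //.
  by rewrite /f2 (periodicn (@cosD2pi R)) (periodicn (@sinD2pi R)).
- rewrite ifF; last by apply/negbTE; rewrite -ltNge; lra.
  rewrite ifT; last by lra.
  rewrite match_start /f2 /X /Y E4x E4l -muln2 PoszM intrM mulrS.
  move: (atan _) => u; rewrite -!pmulrn; ring.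
Qed.

End Index.

(** * Assembly of the two cases *)

Unset Implicit Arguments.

Theorem corollary5p10 (R : realType) (A : 'M[R]_2)
    (detA_gt0 : 0 < \det A) (trA_lt0 : \tr A < 0) :
  exists Delta : set R,
    [/\ countable Delta,
        Delta `<=` `]0, +oo[ &
        forall d : R, 0 < d ->
          (A 1 1 + d * A 0 0 < 2 * Num.sqrt (d * \det A) ->
             forall L : R, 0 < L -> index_zero A d L) /\
          (2 * Num.sqrt (d * \det A) < A 1 1 + d * A 0 0 -> ~ Delta d ->
             exists L0 : R,
               [/\ 0 < L0,
                   index_nonzero A d L0 &
                   exists U : set R,
                     [/\ exists2 V : set R, open V & U = V `&` `[L0, +oo[,
                         `[L0, +oo[ `<=` closure U &
                         forall L : R, U L -> index_nonzero A d L]])].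
Proof.
exists (resonant A); split; first exact: countable_resonant.
  by move=> d [d0 _]; rewrite /= in_itv /= d0.
move=> d d0; split=> [stable L L0|unstable nres].
  exact/index_zero_of_rho2/rho2_0_lt0.
have r0 := rho2_0_gt0 detA_gt0 trA_lt0 d0 unstable.
have [l l0 rl] := rho2_root detA_gt0 trA_lt0 d0 r0.
have k0 : 0 < freq1 A d l by apply: freq1_gt0; rewrite ?rl // ltW.
have cbad := countable_bad_length detA_gt0 trA_lt0 d0.
have long L : pi / freq1 A d l < L -> ~ bad_length A d L -> index_nonzero A d L.
  exact: index_nonzero_of_length.
(* Beyond [pi / freq1 A d l] only the countably many bad lengths are excluded, so [L0] is found
   within one unit. *)
have [L0 /andP[L0k _] L0good] := itv_not_countable cbad
  (ltr_pwDr (@ltr01 R) (lexx (pi / freq1 A d l))).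
have L0_gt0 : 0 < L0 by apply: lt_trans L0k; rewrite divr_gt0 // pi_gt0.
exists L0; split=> //; first exact: long.
(* The sum of squares merges two equations into one continuous function, and [z] runs over the
   compact segment [[0, l]] where [rho2 >= 0]; for [x > 0], [V] is thus the complement of
   [bad_length]. *)
pose f x z := planeX A d x z ^+ 2 + planeY A d x z ^+ 2.
pose V : set R := [set x | forall z, 0 <= z <= l -> f x z != 0].
have good x : 0 < x -> V x -> ~ bad_length A d x.
  move=> x0 Vx [_ [z [z0 rz X0 Y0]]]; have : f x z != 0.
    apply: Vx; rewrite z0 leNgt; apply/negP => lz; move: rz.
    by rewrite leNgt (rho2_gt_lstar detA_gt0 trA_lt0 d0 l0 rl lz).
  by rewrite /f X0 Y0 expr0n addr0 eqxx.
have bad x : 0 < x -> ~ bad_length A d x -> V x.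
  move=> x0 ngood z /andP[z0 zl]; apply/negP.
  rewrite paddr_eq0 ?sqr_ge0 // !sqrf_eq0 => /andP[/eqP X0 /eqP Y0].
  apply: ngood; split=> //; exists z; split=> //.
  by apply: (rho2_ge0 detA_gt0 trA_lt0 d0 rl); rewrite z0.
exists (V `&` `[L0, +oo[); split.
- exists V => //; apply: open_forall_segment => p.
  have c1 : continuous_at p (fun q : R * R => q.1) by exact: cvg_fst.
  have c2 : continuous_at p (fun q : R * R => q.2) by exact: cvg_snd.
  have cX := @continuous_at_planeX _ _ _ A d _ _ c2 c1.
  have cY := @continuous_at_planeY _ _ _ A d _ _ c2 c1.
  exact: (continuous_at_add (continuous_at_mul cX cX) (continuous_at_mul cY cY)).
- move=> x; rewrite /= in_itv /= andbT => L0x B /nbhs_ballP[e /= e0 eB].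
  (* Searching to the right of [x] keeps the approximating length in [[L0, +oo[]. *)
  have [y /andP[xy ye] ygood] := itv_not_countable cbad (ltr_pwDr e0 (lexx x)).
  have L0y : L0 <= y by rewrite (le_trans L0x) // ltW.
  exists y; split.
    split; last by rewrite /= in_itv /= L0y.
    by apply: bad => //; exact: lt_le_trans L0y.
  by apply: eB; rewrite /ball /= ltr0_norm; lra.
- move=> L [VL]; rewrite /= in_itv /= andbT => L0L.
  apply: long; first exact: lt_le_trans L0L.
  by apply: good => //; exact: lt_le_trans L0L.
Qed.
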